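(* Let $A=D[x_1,\ldots,x_n;Q,\mathbb{A},\mathbb{B}]$ be a bi-quadratic algebra such that $D$ is a $K$-algebra over a field $K$ and all the elements $a_{ij,k}$ and $b_{ij}$ belong to $K$. Then the algebra $A$ is a bi-quadratic algebra of Lie type if and only if $A\simeq D\otimes_K(U(\mathcal{G})/(Z-1))$ where $\mathcal{G}$ is a Lie algebra over $K$ of dimension $n+1$ with nontrivial centre $Z(\mathcal{G})$ and $Z\in Z(\mathcal{G})\setminus\{0\}$.
   Context: Let $D$ be a ring with centre $Z(D)$ and $n\ge 2$. Given $Q=(q_{ij})_{i>j}$ with $q_{ij}\in Z(D)$, $\mathbb{A}=(a_{ij,k})$ with $a_{ij,k}\in D$ ($1\le j<i\le n$, $1\le k\le n$) and $\mathbb{B}=(b_{ij})_{i>j}$ with $b_{ij}\in D$, the bi-quadratic algebra $A=D[x_1,\ldots,x_n;Q,\mathbb{A},\mathbb{B}]$ is the ring generated by $D$ and elements $x_1,\ldots,x_n$ subject to the defining relations $x_id=dx_i$ for all $d\in D$ and all $i$, and $x_ix_j-q_{ij}x_jx_i=\sum_{k=1}^na_{ij,k}x_k+b_{ij}$ for all $j<i$. A bi-quadratic algebra is said to be of Lie type if all $q_{ij}=1$. $U(\mathcal{G})$ denotes the universal enveloping algebra of $\mathcal{G}$ and $(Z-1)$ the ideal generated by $Z-1$.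
   Formalization: A is additionally assumed to have a PBW basis (ordered monomials free over D), else ''only if'' fails; ''A is of Lie type'' means A has some presentation over D with all q_ij=1 and a, b in K, not that the given Q is 1; isomorphisms are over D. *)

(* Defs.v *)
From HB Require Import structures.
From mathcomp Require Import all_boot all_order all_algebra.
From mathcomp Require Import boolp.

Set Implicit Arguments.
Unset Strict Implicit.
Unset Printing Implicit Defensive.

Import GRing.Theory.
Local Open Scope ring_scope.
Local Open Scope quotient_scope.

Definition ring_central (R : pzRingType) (z : R) := forall r : R, z * r = r * z.

(* K-algebras, as rings A with a ring morphism from K to the centre of A.
   [algType K] is not used because it imposes 1 != 0: algebras given by
   generators and relations may collapse, and for U(G)/(Z-1) the nontriviality
   is a consequence of the PBW theorem. *)
HB.mixin Record isKAlgebra (K : pzRingType) A of GRing.PzRing A := {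
  kscalar : {rmorphism K -> A};
  kscalar_central : forall c : K, ring_central (kscalar c)
}.
#[short(type="kalgType")]
HB.structure Definition KAlgebra (K : pzRingType) :=
  {A of GRing.PzRing A & isKAlgebra K A}.
Arguments kscalar {K s}.

Section AlgTypeIsKAlgebra.
Variables (K : pzRingType) (A : algType K).
Lemma in_alg_central (c : K) : ring_central (in_alg A c).
Proof. by move=> u; rewrite /= mulr_algl mulr_algr. Qed.
HB.instance Definition _ :=
  isKAlgebra.Build K (GRing.Algebra.sort A) in_alg_central.
End AlgTypeIsKAlgebra.

(* [ringquot S] is the quotient of R by the two-sided ideal generated by S. *)
Section RingQuotient.
Variables (R : pzRingType) (S : R -> Prop).

Inductive ideal_gen : R -> Prop :=
| ideal_gen_sub s : S s -> ideal_gen s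
| ideal_gen0 : ideal_gen 0
| ideal_genD u v : ideal_gen u -> ideal_gen v -> ideal_gen (u + v)
| ideal_genMl r u : ideal_gen u -> ideal_gen (r * u)
| ideal_genMr r u : ideal_gen u -> ideal_gen (u * r).

Lemma ideal_genN u : ideal_gen u -> ideal_gen (- u).
Proof. by move=> Iu; rewrite -mulN1r; apply: ideal_genMl. Qed.

Definition ideal_rel (u v : R) : bool := `[< ideal_gen (u - v) >].

Lemma ideal_rel_refl : reflexive ideal_rel.
Proof. by move=> u; apply/asboolP; rewrite subrr; apply: ideal_gen0. Qed.

Lemma ideal_rel_sym : symmetric ideal_rel.
Proof.
by move=> u v; apply/asboolP/asboolP=> /ideal_genN; rewrite opprB.
Qed.

Lemma ideal_rel_trans : transitive ideal_rel.
Proof.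
move=> v u w /asboolP Iuv /asboolP Ivw; apply/asboolP.
by rewrite -[u](subrK v) -addrA; apply: ideal_genD.
Qed.

Canonical ideal_equiv :=
  EquivRel ideal_rel ideal_rel_refl ideal_rel_sym ideal_rel_trans.

Definition ringquot := {eq_quot ideal_rel}.
HB.instance Definition _ := Choice.on ringquot.

Definition qproj (u : R) : ringquot := \pi_({eq_quot ideal_rel}) u.

Lemma qprojP u v : qproj u = qproj v <-> ideal_gen (u - v).
Proof. by split=> [/eqmodP/asboolP | Iuv]; last exact/eqmodP/asboolP. Qed.

Definition qlift (x : ringquot) : R := repr (x : {eq_quot ideal_rel}).

Lemma qliftK : cancel qlift qproj.
Proof. by move=> x; rewrite /qproj reprK. Qed.

Lemma qliftP u : ideal_gen (qlift (qproj u) - u).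
Proof. by apply/qprojP; rewrite qliftK. Qed.

Definition qadd x y := qproj (qlift x + qlift y).
Definition qopp x := qproj (- qlift x).
Definition qmul x y := qproj (qlift x * qlift y).

Lemma qaddE u v : qadd (qproj u) (qproj v) = qproj (u + v).
Proof.
by apply/qprojP; rewrite opprD addrACA; apply: ideal_genD; apply: qliftP.
Qed.

Lemma qoppE u : qopp (qproj u) = qproj (- u).
Proof. by apply/qprojP; rewrite -opprD; apply/ideal_genN/qliftP. Qed.

Lemma qmulE u v : qmul (qproj u) (qproj v) = qproj (u * v).
Proof.
apply/qprojP; set u' := qlift _; set v' := qlift _.
have -> : u' * v' - u * v = (u' - u) * v' + u * (v' - v).
  by rewrite mulrBl mulrBr addrA subrK.
by apply: ideal_genD; [apply: ideal_genMr | apply: ideal_genMl]; apply: qliftP.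
Qed.

Lemma qprojW (P : ringquot -> Prop) : (forall u, P (qproj u)) -> forall x, P x.
Proof. by move=> Pq x; rewrite -(qliftK x). Qed.

Lemma qaddA : associative qadd.
Proof.
by elim/qprojW=> u; elim/qprojW=> v; elim/qprojW=> w; rewrite !qaddE addrA.
Qed.
Lemma qaddC : commutative qadd.
Proof. by elim/qprojW=> u; elim/qprojW=> v; rewrite !qaddE addrC. Qed.
Lemma qadd0 : left_id (qproj 0) qadd.
Proof. by elim/qprojW=> u; rewrite qaddE add0r. Qed.
Lemma qaddN : left_inverse (qproj 0) qopp qadd.
Proof. by elim/qprojW=> u; rewrite qoppE qaddE addNr. Qed.

HB.instance Definition _ :=
  GRing.isZmodule.Build ringquot qaddA qaddC qadd0 qaddN.

Lemma qmulA : associative qmul.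
Proof.
by elim/qprojW=> u; elim/qprojW=> v; elim/qprojW=> w; rewrite !qmulE mulrA.
Qed.
Lemma qmul1 : left_id (qproj 1) qmul.
Proof. by elim/qprojW=> u; rewrite qmulE mul1r. Qed.
Lemma qmulr1 : right_id (qproj 1) qmul.
Proof. by elim/qprojW=> u; rewrite qmulE mulr1. Qed.
Lemma qmulDl : left_distributive qmul +%R.
Proof.
elim/qprojW=> u; elim/qprojW=> v; elim/qprojW=> w.
by rewrite -[LHS]/(qmul (qadd _ _) _) -[RHS]/(qadd _ _) !(qaddE, qmulE) mulrDl.
Qed.
Lemma qmulDr : right_distributive qmul +%R.
Proof.
elim/qprojW=> u; elim/qprojW=> v; elim/qprojW=> w.
by rewrite -[LHS]/(qmul _ (qadd _ _)) -[RHS]/(qadd _ _) !(qaddE, qmulE) mulrDr.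
Qed.

HB.instance Definition _ :=
  GRing.Zmodule_isPzRing.Build ringquot qmulA qmul1 qmulr1 qmulDl qmulDr.

Lemma qproj_is_additive : additive qproj.
Proof. by move=> u v; rewrite -[RHS]/(qadd _ (qopp _)) qoppE qaddE. Qed.
HB.instance Definition _ :=
  GRing.isZmodMorphism.Build R ringquot qproj qproj_is_additive.

Lemma qproj_is_monoid_morphism : monoid_morphism qproj.
Proof. by split=> // u v; rewrite -[RHS]/(qmul _ _) qmulE. Qed.
HB.instance Definition _ :=
  GRing.isMonoidMorphism.Build R ringquot qproj qproj_is_monoid_morphism.

End RingQuotient.

Section AlgebraQuotient.
Variables (K : pzRingType) (A : kalgType K) (S : A -> Prop).

Definition qscalar : K -> ringquot S := qproj S \o kscalar.
HB.instance Definition _ := GRing.RMorphism.on qscalar.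

Lemma qscalar_central (c : K) : ring_central (qscalar c).
Proof.
by elim/qprojW=> u; rewrite /qscalar /= -!rmorphM kscalar_central.
Qed.

HB.instance Definition _ := isKAlgebra.Build K (ringquot S) qscalar_central.

End AlgebraQuotient.

(* Terms for the ring freely generated by a ring D and a set X: elements of D
   are not assumed to commute with the generators. *)
Inductive fterm (D X : Type) :=
| FCoef of D
| FGen of X
| FAdd of fterm D X & fterm D X
| FOpp of fterm D X
| FMul of fterm D X & fterm D X.
Arguments FCoef {D X} _.
Arguments FGen {D X} _.

Section FreeRing.
Variables (D : pzRingType) (X : Type).
Local Notation T := (fterm D X).
Implicit Types (s t u : T) (d e : D).

HB.instance Definition _ := gen_eqMixin T.
HB.instance Definition _ := gen_choiceMixin T.

Inductive fequiv : T -> T -> Prop :=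
| feq_refl s : fequiv s s
| feq_sym s t : fequiv s t -> fequiv t s
| feq_trans s t u : fequiv s t -> fequiv t u -> fequiv s u
| feq_add s s' t t' : fequiv s s' -> fequiv t t' -> fequiv (FAdd s t) (FAdd s' t')
| feq_opp s s' : fequiv s s' -> fequiv (FOpp s) (FOpp s')
| feq_mul s s' t t' : fequiv s s' -> fequiv t t' -> fequiv (FMul s t) (FMul s' t')
| feq_addA s t u : fequiv (FAdd s (FAdd t u)) (FAdd (FAdd s t) u)
| feq_addC s t : fequiv (FAdd s t) (FAdd t s)
| feq_add0 s : fequiv (FAdd (FCoef 0) s) s
| feq_addN s : fequiv (FAdd (FOpp s) s) (FCoef 0)
| feq_mulA s t u : fequiv (FMul s (FMul t u)) (FMul (FMul s t) u)
| feq_mul1l s : fequiv (FMul (FCoef 1) s) s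
| feq_mul1r s : fequiv (FMul s (FCoef 1)) s
| feq_mulDl s t u : fequiv (FMul (FAdd s t) u) (FAdd (FMul s u) (FMul t u))
| feq_mulDr s t u : fequiv (FMul s (FAdd t u)) (FAdd (FMul s t) (FMul s u))
| feq_coefD d e : fequiv (FCoef (d + e)) (FAdd (FCoef d) (FCoef e))
| feq_coefM d e : fequiv (FCoef (d * e)) (FMul (FCoef d) (FCoef e)).

Definition frel s t : bool := `[< fequiv s t >].

Lemma frel_refl : reflexive frel.
Proof. by move=> s; apply/asboolP/feq_refl. Qed.
Lemma frel_sym : symmetric frel.
Proof. by move=> s t; apply/asboolP/asboolP => /feq_sym. Qed.
Lemma frel_trans : transitive frel.
Proof. by move=> t s u /asboolP st /asboolP tu; apply/asboolP/(feq_trans st). Qed.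

Canonical fequiv_equiv := EquivRel frel frel_refl frel_sym frel_trans.

Definition free_ring := {eq_quot frel}.
HB.instance Definition _ := Choice.on free_ring.

Definition fclass s : free_ring := \pi_({eq_quot frel}) s.
Definition frepr (x : free_ring) : T := repr (x : {eq_quot frel}).

Lemma fclassP s t : fclass s = fclass t <-> fequiv s t.
Proof. by split=> [/eqmodP/asboolP | st]; last exact/eqmodP/asboolP. Qed.

Lemma freprK : cancel frepr fclass.
Proof. by move=> x; rewrite /fclass reprK. Qed.

Lemma freprP s : fequiv (frepr (fclass s)) s.
Proof. by apply/fclassP; rewrite freprK. Qed.

Lemma fclassW (P : free_ring -> Prop) :
  (forall s, P (fclass s)) -> forall x, P x.
Proof. by move=> Pq x; rewrite -(freprK x). Qed.

Definition fadd x y := fclass (FAdd (frepr x) (frepr y)).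
Definition fopp x := fclass (FOpp (frepr x)).
Definition fmul x y := fclass (FMul (frepr x) (frepr y)).

Lemma faddE s t : fadd (fclass s) (fclass t) = fclass (FAdd s t).
Proof. by apply/fclassP/feq_add; apply: freprP. Qed.
Lemma foppE s : fopp (fclass s) = fclass (FOpp s).
Proof. exact/fclassP/feq_opp/freprP. Qed.
Lemma fmulE s t : fmul (fclass s) (fclass t) = fclass (FMul s t).
Proof. by apply/fclassP/feq_mul; apply: freprP. Qed.

Lemma faddA : associative fadd.
Proof.
elim/fclassW=> s; elim/fclassW=> t; elim/fclassW=> u.
by rewrite !faddE; apply/fclassP/feq_addA.
Qed.
Lemma faddC : commutative fadd.
Proof.
by elim/fclassW=> s; elim/fclassW=> t; rewrite !faddE; apply/fclassP/feq_addC.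
Qed.
Lemma fadd0 : left_id (fclass (FCoef 0)) fadd.
Proof. by elim/fclassW=> s; rewrite faddE; apply/fclassP/feq_add0. Qed.
Lemma faddN : left_inverse (fclass (FCoef 0)) fopp fadd.
Proof. by elim/fclassW=> s; rewrite foppE faddE; apply/fclassP/feq_addN. Qed.

HB.instance Definition _ :=
  GRing.isZmodule.Build free_ring faddA faddC fadd0 faddN.

Lemma fclassD s t : fclass (FAdd s t) = fclass s + fclass t.
Proof. by rewrite -faddE. Qed.
Lemma fclassN s : fclass (FOpp s) = - fclass s.
Proof. by rewrite -foppE. Qed.

Lemma fmulA : associative fmul.
Proof.
elim/fclassW=> s; elim/fclassW=> t; elim/fclassW=> u.
by rewrite !fmulE; apply/fclassP/feq_mulA.
Qed.
Lemma fmul1 : left_id (fclass (FCoef 1)) fmul.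
Proof. by elim/fclassW=> s; rewrite fmulE; apply/fclassP/feq_mul1l. Qed.
Lemma fmulr1 : right_id (fclass (FCoef 1)) fmul.
Proof. by elim/fclassW=> s; rewrite fmulE; apply/fclassP/feq_mul1r. Qed.
Lemma fmulDl : left_distributive fmul +%R.
Proof.
elim/fclassW=> s; elim/fclassW=> t; elim/fclassW=> u.
rewrite -fclassD !fmulE -fclassD.
exact/fclassP/feq_mulDl.
Qed.
Lemma fmulDr : right_distributive fmul +%R.
Proof.
elim/fclassW=> s; elim/fclassW=> t; elim/fclassW=> u.
rewrite -fclassD !fmulE -fclassD.
exact/fclassP/feq_mulDr.
Qed.

HB.instance Definition _ :=
  GRing.Zmodule_isPzRing.Build free_ring fmulA fmul1 fmulr1 fmulDl fmulDr.

Lemma fclassM s t : fclass (FMul s t) = fclass s * fclass t.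
Proof. by rewrite -fmulE. Qed.

Definition fcoef d : free_ring := fclass (FCoef d).
Definition fgen (x : X) : free_ring := fclass (FGen x).

Lemma fcoefD : {morph fcoef : d e / d + e}.
Proof.
move=> d e; rewrite /fcoef -fclassD.
exact/fclassP/feq_coefD.
Qed.
Lemma fcoef_is_additive : additive fcoef.
Proof.
by move=> d e; apply: (addIr (fcoef e)); rewrite subrK -fcoefD subrK.
Qed.
HB.instance Definition _ :=
  GRing.isZmodMorphism.Build D free_ring fcoef fcoef_is_additive.

Lemma fcoef_is_monoid_morphism : monoid_morphism fcoef.
Proof.
split=> // d e; rewrite /fcoef -fclassM.
exact/fclassP/feq_coefM.
Qed.
HB.instance Definition _ :=
  GRing.isMonoidMorphism.Build D free_ring fcoef fcoef_is_monoid_morphism.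

End FreeRing.

Section FreeAlgebra.
Variables (K : comPzRingType) (X : Type).

Definition scalar_comm_rel (r : free_ring K X) : Prop :=
  exists (c : K) (x : X), r = fcoef X c * fgen K x - fgen K x * fcoef X c.

Definition free_alg := ringquot scalar_comm_rel.
HB.instance Definition _ := GRing.PzRing.on free_alg.

Definition falg_gen (x : X) : free_alg := qproj scalar_comm_rel (fgen K x).
Definition falg_coef : K -> free_alg := qproj scalar_comm_rel \o fcoef X.
HB.instance Definition _ := GRing.RMorphism.on falg_coef.

Lemma falg_coef_central c : ring_central (falg_coef c).
Proof.
elim/qprojW; elim/fclassW; elim=> [d | x | s IHs t IHt | s IHs | s IHs t IHt].
- by rewrite /falg_coef /= -[fclass _]/(fcoef X d) -!rmorphM /= mulrC rmorphM.
- rewrite /falg_coef /= -[fclass _]/(fgen K x) -!rmorphM; apply/qprojP.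
  by apply: ideal_gen_sub; exists c, x.
- by rewrite fclassD rmorphD mulrDr mulrDl IHs IHt.
- by rewrite fclassN rmorphN mulrN mulNr IHs.
- by rewrite fclassM rmorphM mulrA IHs -mulrA IHt mulrA.
Qed.

HB.instance Definition _ := isKAlgebra.Build K free_alg falg_coef_central.

End FreeAlgebra.

HB.mixin Record isLieAlgebra (K : fieldType) G of Vector K G := {
  lie_br : G -> G -> G;
  lie_brDl : forall x y z : G, lie_br (x + y) z = lie_br x z + lie_br y z;
  lie_brDr : forall x y z : G, lie_br x (y + z) = lie_br x y + lie_br x z;
  lie_brZl : forall (c : K) (x y : G), lie_br (c *: x) y = c *: lie_br x y;
  lie_brZr : forall (c : K) (x y : G), lie_br x (c *: y) = c *: lie_br x y;
  lie_brxx : forall x : G, lie_br x x = 0;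
  lie_jacobi : forall x y z : G,
    lie_br x (lie_br y z) + lie_br y (lie_br z x) + lie_br z (lie_br x y) = 0
}.
#[short(type="lieAlgType")]
HB.structure Definition LieAlgebra (K : fieldType) :=
  {G of Vector K G & isLieAlgebra K G}.

Definition lie_center (K : fieldType) (G : lieAlgType K) (z : G) :=
  forall x : G, lie_br z x = 0.

Section Enveloping.
Variables (K : fieldType) (G : lieAlgType K).
Local Notation "[ 'g' x ]" := (falg_gen K (x : G)) (format "[ 'g'  x ]").

Definition uea_rel (r : free_alg K G) : Prop :=
  (exists (c : K) (x y : G), r = [g c *: x + y] - (kscalar c * [g x] + [g y])) \/
  (exists x y : G, r = [g x] * [g y] - [g y] * [g x] - [g lie_br x y]).

Definition uea := ringquot uea_rel.
HB.instance Definition _ := KAlgebra.on uea.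

Definition uea_inj (x : G) : uea := qproj uea_rel [g x].

Definition mod1_rel (Z : G) (u : uea) : Prop := u = uea_inj Z - 1.

Definition uea_mod1 (Z : G) := ringquot (mod1_rel Z).
HB.instance Definition _ (Z : G) := KAlgebra.on (uea_mod1 Z).

End Enveloping.

(* A (x)_K B as the abelian group on symbols a (x) b modulo K-balanced
   biadditivity; [tmul] is (a (x) b)(a' (x) b') = aa' (x) bb'. *)
Inductive tterm (A B : Type) :=
| TZero
| TPure of A & B
| TAdd of tterm A B & tterm A B
| TOpp of tterm A B.
Arguments TZero {A B}.

Section Tensor.
Variables (K : comPzRingType) (A B : kalgType K).
Local Notation T := (tterm A B).
Implicit Types (a : A) (b : B) (s t u : T).

HB.instance Definition _ := gen_eqMixin T.
HB.instance Definition _ := gen_choiceMixin T.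

Inductive tequiv : T -> T -> Prop :=
| teq_refl s : tequiv s s
| teq_sym s t : tequiv s t -> tequiv t s
| teq_trans s t u : tequiv s t -> tequiv t u -> tequiv s u
| teq_add s s' t t' : tequiv s s' -> tequiv t t' -> tequiv (TAdd s t) (TAdd s' t')
| teq_opp s s' : tequiv s s' -> tequiv (TOpp s) (TOpp s')
| teq_addA s t u : tequiv (TAdd s (TAdd t u)) (TAdd (TAdd s t) u)
| teq_addC s t : tequiv (TAdd s t) (TAdd t s)
| teq_add0 s : tequiv (TAdd TZero s) s
| teq_addN s : tequiv (TAdd (TOpp s) s) TZero
| teq_pureDl a a' b : tequiv (TPure (a + a') b) (TAdd (TPure a b) (TPure a' b))
| teq_pureDr a b b' : tequiv (TPure a (b + b')) (TAdd (TPure a b) (TPure a b'))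
| teq_pureZ (c : K) a b : tequiv (TPure (a * kscalar c) b) (TPure a (kscalar c * b)).

Fixpoint tmull a b t : T := match t with
  | TZero => TZero
  | TPure a' b' => TPure (a * a') (b * b')
  | TAdd t1 t2 => TAdd (tmull a b t1) (tmull a b t2)
  | TOpp t1 => TOpp (tmull a b t1)
  end.

Fixpoint tmul s t : T := match s with
  | TZero => TZero
  | TPure a b => tmull a b t
  | TAdd s1 s2 => TAdd (tmul s1 t) (tmul s2 t)
  | TOpp s1 => TOpp (tmul s1 t)
  end.

Definition trel s t : bool := `[< tequiv s t >].

Lemma trel_refl : reflexive trel.
Proof. by move=> s; apply/asboolP/teq_refl. Qed.
Lemma trel_sym : symmetric trel.
Proof. by move=> s t; apply/asboolP/asboolP => /teq_sym. Qed.
Lemma trel_trans : transitive trel.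
Proof. by move=> t s u /asboolP st /asboolP tu; apply/asboolP/(teq_trans st). Qed.

Canonical tequiv_equiv := EquivRel trel trel_refl trel_sym trel_trans.

Definition tensor := {eq_quot trel}.
HB.instance Definition _ := Choice.on tensor.

Definition tclass s : tensor := \pi_({eq_quot trel}) s.
Definition trepr (x : tensor) : T := repr (x : {eq_quot trel}).

Lemma tclassP s t : tclass s = tclass t <-> tequiv s t.
Proof. by split=> [/eqmodP/asboolP | st]; last exact/eqmodP/asboolP. Qed.

Lemma treprK : cancel trepr tclass.
Proof. by move=> x; rewrite /tclass reprK. Qed.

Lemma treprP s : tequiv (trepr (tclass s)) s.
Proof. by apply/tclassP; rewrite treprK. Qed.

Lemma tclassW (P : tensor -> Prop) : (forall s, P (tclass s)) -> forall x, P x.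
Proof. by move=> Pq x; rewrite -(treprK x). Qed.

Definition tadd x y := tclass (TAdd (trepr x) (trepr y)).
Definition topp x := tclass (TOpp (trepr x)).
Definition ttimes x y := tclass (tmul (trepr x) (trepr y)).

Lemma taddE s t : tadd (tclass s) (tclass t) = tclass (TAdd s t).
Proof. by apply/tclassP/teq_add; apply: treprP. Qed.
Lemma toppE s : topp (tclass s) = tclass (TOpp s).
Proof. exact/tclassP/teq_opp/treprP. Qed.

Lemma taddA : associative tadd.
Proof.
elim/tclassW=> s; elim/tclassW=> t; elim/tclassW=> u.
by rewrite !taddE; apply/tclassP/teq_addA.
Qed.
Lemma taddC : commutative tadd.
Proof.
by elim/tclassW=> s; elim/tclassW=> t; rewrite !taddE; apply/tclassP/teq_addC.
Qed.
Lemma tadd0 : left_id (tclass TZero) tadd.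
Proof. by elim/tclassW=> s; rewrite taddE; apply/tclassP/teq_add0. Qed.
Lemma taddN : left_inverse (tclass TZero) topp tadd.
Proof. by elim/tclassW=> s; rewrite toppE taddE; apply/tclassP/teq_addN. Qed.

HB.instance Definition _ := GRing.isZmodule.Build tensor taddA taddC tadd0 taddN.

Definition tpure a b : tensor := tclass (TPure a b).

Lemma tclass0 : tclass TZero = 0. Proof. by []. Qed.
Lemma tclassD s t : tclass (TAdd s t) = tclass s + tclass t.
Proof. by rewrite -taddE. Qed.
Lemma tclassN s : tclass (TOpp s) = - tclass s.
Proof. by rewrite -toppE. Qed.
Lemma tpureDl a a' b : tpure (a + a') b = tpure a b + tpure a' b.
Proof. by rewrite -tclassD; apply/tclassP/teq_pureDl. Qed.
Lemma tpureDr a b b' : tpure a (b + b') = tpure a b + tpure a b'.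
Proof. by rewrite -tclassD; apply/tclassP/teq_pureDr. Qed.
Lemma tpureZ (c : K) a b : tpure (a * kscalar c) b = tpure a (kscalar c * b).
Proof. exact/tclassP/teq_pureZ. Qed.

Lemma tmull_class a b t t' :
  tequiv t t' -> tclass (tmull a b t) = tclass (tmull a b t').
Proof.
elim=> {t t'} //=.
- by move=> s t u _ -> _ ->.
- by move=> s s' t t' _ IHs _ IHt; rewrite !tclassD IHs IHt.
- by move=> s s' _ IHs; rewrite !tclassN IHs.
- by move=> s t u; rewrite !tclassD addrA.
- by move=> s t; rewrite !tclassD addrC.
- by move=> s; rewrite tclassD add0r.
- by move=> s; rewrite tclassD tclassN addNr.
- by move=> a1 a2 b1; rewrite tclassD mulrDr; apply: tpureDl.
- by move=> a1 b1 b2; rewrite tclassD mulrDr; apply: tpureDr.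
- move=> c a1 b1.
  have -> : b * (kscalar c * b1) = kscalar c * (b * b1).
    by rewrite !mulrA kscalar_central.
  by rewrite mulrA; apply: tpureZ.
Qed.

Lemma tmul_classr s t t' :
  tequiv t t' -> tclass (tmul s t) = tclass (tmul s t').
Proof.
move=> tt'; elim: s => //= [a b | s IHs u IHu | s IHs].
- exact: tmull_class.
- by rewrite !tclassD IHs IHu.
- by rewrite !tclassN IHs.
Qed.

Lemma tmull_addl a a' b t :
  tclass (tmull (a + a') b t) = tclass (tmull a b t) + tclass (tmull a' b t).
Proof.
elim: t => //= [| a1 b1 | s IHs t IHt | s IHs].
- by rewrite !tclass0 addr0.
- by rewrite mulrDl; apply: tpureDl.
- by rewrite !tclassD IHs IHt addrACA.
- by rewrite !tclassN IHs opprD.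
Qed.

Lemma tmull_addr a b b' t :
  tclass (tmull a (b + b') t) = tclass (tmull a b t) + tclass (tmull a b' t).
Proof.
elim: t => //= [| a1 b1 | s IHs t IHt | s IHs].
- by rewrite !tclass0 addr0.
- by rewrite mulrDl; apply: tpureDr.
- by rewrite !tclassD IHs IHt addrACA.
- by rewrite !tclassN IHs opprD.
Qed.

Lemma tmull_scale (c : K) a b t :
  tclass (tmull (a * kscalar c) b t) = tclass (tmull a (kscalar c * b) t).
Proof.
elim: t => //= [a1 b1 | s IHs t IHt | s IHs].
- have -> : a * kscalar c * a1 = a * a1 * kscalar c.
    by rewrite -!mulrA kscalar_central.
  by rewrite -(mulrA (kscalar c)); apply: tpureZ.
- by rewrite !tclassD IHs IHt.
- by rewrite !tclassN IHs.
Qed.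

Lemma tmul_classl s s' t :
  tequiv s s' -> tclass (tmul s t) = tclass (tmul s' t).
Proof.
elim=> {s s'} //=.
- by move=> s1 s2 s3 _ -> _ ->.
- by move=> s1 s1' s2 s2' _ IH1 _ IH2; rewrite !tclassD IH1 IH2.
- by move=> s1 s1' _ IH1; rewrite !tclassN IH1.
- by move=> s1 s2 s3; rewrite !tclassD addrA.
- by move=> s1 s2; rewrite !tclassD addrC.
- by move=> s1; rewrite tclassD add0r.
- by move=> s1; rewrite tclassD tclassN addNr.
- by move=> a a' b; rewrite tclassD tmull_addl.
- by move=> a b b'; rewrite tclassD tmull_addr.
- by move=> c a b; rewrite tmull_scale.
Qed.

Lemma ttimesE s t : ttimes (tclass s) (tclass t) = tclass (tmul s t).
Proof. by rewrite /ttimes (tmul_classl _ (treprP s)) (tmul_classr _ (treprP t)). Qed.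

Lemma tmul_addr s t u :
  tclass (tmul s (TAdd t u)) = tclass (tmul s t) + tclass (tmul s u).
Proof.
elim: s => [| a b | s1 IH1 s2 IH2 | s1 IH1] /=.
- by rewrite tclass0 addr0.
- by rewrite tclassD.
- by rewrite !tclassD IH1 IH2 addrACA.
- by rewrite !tclassN IH1 opprD.
Qed.

Lemma tmull_mulA a b s t :
  tclass (tmull a b (tmul s t)) = tclass (tmul (tmull a b s) t).
Proof.
elim: s => [| a1 b1 | s1 IH1 s2 IH2 | s1 IH1] //=.
- elim: t => [| a2 b2 | t1 IH1 t2 IH2 | t1 IH1] //=.
  + by rewrite !mulrA.
  + by rewrite !tclassD IH1 IH2.
  + by rewrite !tclassN IH1.
- by rewrite !tclassD IH1 IH2.
- by rewrite !tclassN IH1.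
Qed.

Lemma ttimesA : associative ttimes.
Proof.
elim/tclassW=> s; elim/tclassW=> t; elim/tclassW=> u; rewrite !ttimesE.
elim: s => [| a b | s1 IH1 s2 IH2 | s1 IH1] //=.
- exact: tmull_mulA.
- by rewrite !tclassD IH1 IH2.
- by rewrite !tclassN IH1.
Qed.

Lemma ttimes1 : left_id (tpure 1 1) ttimes.
Proof.
elim/tclassW=> s; rewrite ttimesE /=.
elim: s => [| a b | s1 IH1 s2 IH2 | s1 IH1] //=.
- by rewrite !mul1r.
- by rewrite !tclassD IH1 IH2.
- by rewrite !tclassN IH1.
Qed.

Lemma ttimesr1 : right_id (tpure 1 1) ttimes.
Proof.
elim/tclassW=> s; rewrite ttimesE.
elim: s => [| a b | s1 IH1 s2 IH2 | s1 IH1] //=.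
- by rewrite !mulr1.
- by rewrite !tclassD IH1 IH2.
- by rewrite !tclassN IH1.
Qed.

Lemma ttimesDl : left_distributive ttimes +%R.
Proof.
elim/tclassW=> s; elim/tclassW=> t; elim/tclassW=> u.
by rewrite -tclassD !ttimesE /= tclassD.
Qed.

Lemma ttimesDr : right_distributive ttimes +%R.
Proof.
elim/tclassW=> s; elim/tclassW=> t; elim/tclassW=> u.
by rewrite -tclassD !ttimesE tmul_addr.
Qed.

HB.instance Definition _ :=
  GRing.Zmodule_isPzRing.Build tensor ttimesA ttimes1 ttimesr1 ttimesDl ttimesDr.

Lemma tpureM a a' b b' : tpure a b * tpure a' b' = tpure (a * a') (b * b').
Proof. by rewrite -[LHS]/(ttimes _ _) ttimesE. Qed.

Definition tensor_l a : tensor := tpure a 1.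

Lemma tensor_l_is_additive : additive tensor_l.
Proof.
move=> a a'; apply: (addIr (tensor_l a')).
by rewrite subrK /tensor_l -tpureDl subrK.
Qed.
HB.instance Definition _ :=
  GRing.isZmodMorphism.Build A tensor tensor_l tensor_l_is_additive.

Lemma tensor_l_is_monoid_morphism : monoid_morphism tensor_l.
Proof. by split=> // a a'; rewrite /tensor_l tpureM mulr1. Qed.
HB.instance Definition _ :=
  GRing.isMonoidMorphism.Build A tensor tensor_l tensor_l_is_monoid_morphism.

End Tensor.


(* Indices run over 'I_n, i.e. 0..n-1 instead of 1..n, and only the entries
   with j < i are constrained or used. *)
Record bq_data (D : pzRingType) (n : nat) := BQData {
  bq_q : 'I_n -> 'I_n -> D;
  bq_a : 'I_n -> 'I_n -> 'I_n -> D;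
  bq_b : 'I_n -> 'I_n -> D;
  bq_q_central : forall i j : 'I_n, (j < i)%N -> ring_central (bq_q i j)
}.

Section BiQuadratic.
Variables (D : pzRingType) (n : nat) (s : bq_data D n).
Local Notation "''x_' i" := (fgen D (i : 'I_n)) (at level 8, i at level 2).
Local Notation c := (fcoef 'I_n).

Definition bq_rel (r : free_ring D 'I_n) : Prop :=
  (exists (i : 'I_n) (d : D), r = 'x_i * c d - c d * 'x_i) \/
  (exists i j : 'I_n, (j < i)%N /\
     r = 'x_i * 'x_j - c (bq_q s i j) * 'x_j * 'x_i
         - (\sum_(k < n) c (bq_a s i j k) * 'x_k + c (bq_b s i j))).

(* D[x_1, ..., x_n; Q, A, B] *)
Definition biquad := ringquot bq_rel.
HB.instance Definition _ := GRing.PzRing.on biquad.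

Definition bq_coef : D -> biquad := qproj bq_rel \o fcoef 'I_n.
HB.instance Definition _ := GRing.RMorphism.on bq_coef.
Definition bq_x (i : 'I_n) : biquad := qproj bq_rel (fgen D i).

(* the ordered monomial x_1^{al_1} ... x_n^{al_n} *)
Definition bq_monom (al : {ffun 'I_n -> nat}) : biquad :=
  \prod_(i < n) bq_x i ^+ al i.

(* A is a free left D-module on the ordered monomials *)
Definition has_PBW_basis : Prop :=
  (forall u : biquad, exists (m : seq {ffun 'I_n -> nat})
      (d : {ffun 'I_n -> nat} -> D),
      u = \sum_(al <- m) bq_coef (d al) * bq_monom al) /\
  (forall (m : seq {ffun 'I_n -> nat}) (d : {ffun 'I_n -> nat} -> D),
      uniq m -> \sum_(al <- m) bq_coef (d al) * bq_monom al = 0 ->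
      forall al, al \in m -> d al = 0).

Definition lie_type_data : Prop :=
  forall i j : 'I_n, (j < i)%N -> bq_q s i j = 1.

End BiQuadratic.

Definition scalar_data (K : fieldType) (D : kalgType K) n (s : bq_data D n) :=
  forall i j : 'I_n, (j < i)%N ->
    (forall k : 'I_n, exists c : K, bq_a s i j k = kscalar c) /\
    (exists c : K, bq_b s i j = kscalar c).

(* Isomorphism of rings over D; when D is a K-algebra this is in particular an
   isomorphism of K-algebras. *)
Definition iso_over (D A B : pzRingType) (f : D -> A) (g : D -> B) : Prop :=
  exists phi : {rmorphism A -> B}, bijective phi /\ forall d, phi (f d) = g d.

(* Being a bi-quadratic algebra of Lie type (with a_ij,k and b_ij in K) is a
   property of the algebra, not of a chosen presentation: over D = K[e]/(e^2),
   K of characteristic 0, the algebra with the single quadratic relation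
   x2 x1 - (1 + e) x1 x2 = x1 becomes y x1 - x1 y = x1 for
   y = x2 - e x2 (x2 - 1) / 2. *)
Definition of_lie_type (K : fieldType) (D : kalgType K) n (s : bq_data D n) :=
  exists t : bq_data D n,
    [/\ scalar_data t, lie_type_data t & iso_over (bq_coef s) (bq_coef t)].

(* Main.v *)
(* A Lie type presentation [t] of A defines a bracket on K Z + K x_1 + ... + K x_n
   whose Jacobi identity holds in A, and hence holds as soon as 1, x_1, ..., x_n
   are K-linearly independent in A. Otherwise A would be spanned over D by ordered
   monomials in n - 1 elements commuting with D, against the growth of the PBW
   basis of [s]. Given the Lie algebra, A and D (x) U(G)/(Z - 1) have the same
   generators and relations, so the PBW theorem for U(G) is never used; read
   backwards, a basis of G containing Z gives a presentation of Lie type. *)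

From HB Require Import structures.
Require Import Defs.
From mathcomp Require Import all_boot all_order all_algebra.
From mathcomp Require Import boolp.

Set Implicit Arguments.
Unset Strict Implicit.
Unset Printing Implicit Defensive.

Import GRing.Theory.
Local Open Scope ring_scope.

(** * Universal properties *)

(** [D] may be noncommutative and need not have invariant basis number, so ranks of free [D]-modules
    cannot simply be compared. Moreover the PBW hypothesis concerns [s] while the Lie type relations
    belong to [t], and an isomorphism over [D] need not respect degrees, so leading terms cannot be
    matched; only growth survives. The counting is therefore moved to matrices over the centre of
    [D]: an element commuting with [D] has central PBW coefficients, and over a nonzero commutative
    ring a matrix with more columns than rows kills a nonzero vector. That the dependence has
    coefficients in the field [K] is what allows one generator to be eliminated: a nonzero
    coefficient can be inverted. The zero ring [D], for which the PBW property is vacuous and the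
    count breaks down, is treated apart. *)

Section FreeRingLift.
Variables (D A : pzRingType) (X : Type) (f : {rmorphism D -> A}) (y : X -> A).

Fixpoint feval (t : fterm D X) : A := match t with
  | FCoef d => f d
  | FGen x => y x
  | FAdd t1 t2 => feval t1 + feval t2
  | FOpp t1 => - feval t1
  | FMul t1 t2 => feval t1 * feval t2
  end.

Lemma feval_fequiv s t : fequiv s t -> feval s = feval t.
Proof.
elim=> {s t} //=.
- by move=> s t u _ -> _ ->.
- by move=> s s' t t' _ -> _ ->.
- by move=> s s' _ ->.
- by move=> s s' t t' _ -> _ ->.
- by move=> s t u; rewrite addrA.
- by move=> s t; rewrite addrC.
- by move=> s; rewrite rmorph0 add0r.
- by move=> s; rewrite rmorph0 addNr.
- by move=> s t u; rewrite mulrA.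
- by move=> s; rewrite rmorph1 mul1r.
- by move=> s; rewrite rmorph1 mulr1.
- by move=> s t u; rewrite mulrDl.
- by move=> s t u; rewrite mulrDr.
- by move=> d e; rewrite rmorphD.
- by move=> d e; rewrite rmorphM.
Qed.

Definition flift (x : free_ring D X) : A := feval (frepr x).

Lemma flift_fclass t : flift (fclass t) = feval t.
Proof. exact/feval_fequiv/freprP. Qed.

Lemma flift_is_additive : additive flift.
Proof.
elim/fclassW=> s; elim/fclassW=> t.
by rewrite -fclassN -fclassD !flift_fclass.
Qed.
HB.instance Definition _ :=
  GRing.isZmodMorphism.Build (free_ring D X) A flift flift_is_additive.

Lemma flift_is_monoid_morphism : monoid_morphism flift.
Proof.
split; first by rewrite -[1]/(fclass (FCoef 1)) flift_fclass /= rmorph1.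
by elim/fclassW=> s; elim/fclassW=> t; rewrite -fclassM !flift_fclass.
Qed.
HB.instance Definition _ :=
  GRing.isMonoidMorphism.Build (free_ring D X) A flift flift_is_monoid_morphism.

Lemma free_ring_lift : exists phi : {rmorphism free_ring D X -> A},
  (forall d, phi (fcoef X d) = f d) /\ (forall x, phi (fgen D x) = y x).
Proof. by exists flift; split=> [d|x]; apply: flift_fclass. Qed.

End FreeRingLift.

Section RingquotLift.
Variables (R A : pzRingType) (S : R -> Prop) (f : {rmorphism R -> A}).
Hypothesis fS0 : forall r, S r -> f r = 0.

Lemma ideal_gen_kernel u : ideal_gen S u -> f u = 0.
Proof.
elim=> {u} [r /fS0 //||u v _ fu _ fv|r u _ fu|r u _ fu].
- by rewrite rmorph0.
- by rewrite rmorphD fu fv addr0.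
- by rewrite rmorphM fu mulr0.
- by rewrite rmorphM fu mul0r.
Qed.

Definition qdesc (x : ringquot S) : A := f (qlift x).

Lemma qdesc_qproj u : qdesc (qproj S u) = f u.
Proof. by apply/subr0_eq; rewrite -rmorphB ideal_gen_kernel //; apply: qliftP. Qed.

Lemma qdesc_is_additive : additive qdesc.
Proof.
elim/qprojW=> u; elim/qprojW=> v.
by rewrite -rmorphB !qdesc_qproj rmorphB.
Qed.

Lemma qdesc_is_monoid_morphism : monoid_morphism qdesc.
Proof.
split; first by rewrite -(rmorph1 (qproj S)) qdesc_qproj rmorph1.
by elim/qprojW=> u; elim/qprojW=> v; rewrite -rmorphM !qdesc_qproj rmorphM.
Qed.

Lemma ringquot_lift :
  exists phi : {rmorphism ringquot S -> A}, forall u, phi (qproj S u) = f u.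
Proof.
(* The morphism laws depend on [fS0], so the structure is packed locally and not declared as an
   instance. *)
pose aP := GRing.isZmodMorphism.Build _ _ qdesc qdesc_is_additive.
pose mP := GRing.isMonoidMorphism.Build _ _ qdesc qdesc_is_monoid_morphism.
pose phi : {rmorphism ringquot S -> A} := HB.pack qdesc aP mP.
by exists phi; apply: qdesc_qproj.
Qed.

End RingquotLift.

(** An induction principle that passes to quotients one layer at a time, as the nested quotients
    defining [uea_mod1] require. There are no clauses for 0 and 1 because the sets [T] used below
    contain the image of a coefficient ring. *)
Definition ring_generated (R : pzRingType) (T : R -> Prop) :=
  forall P : R -> Prop, (forall u, T u -> P u) ->
  (forall u v, P u -> P v -> P (u + v)) -> (forall u, P u -> P (- u)) ->
  (forall u v, P u -> P v -> P (u * v)) -> forall u, P u.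

Lemma free_ring_generated (D : pzRingType) (X : Type) :
  ring_generated (fun u : free_ring D X =>
    (exists d, u = fcoef X d) \/ (exists x, u = fgen D x)).
Proof.
move=> P PT Pa Po Pm; elim/fclassW; elim=> [d|x|s Ps t Pt|s Ps|s Ps t Pt].
- by apply: PT; left; exists d.
- by apply: PT; right; exists x.
- by rewrite fclassD; apply: Pa.
- by rewrite fclassN; apply: Po.
- by rewrite fclassM; apply: Pm.
Qed.

Lemma ringquot_generated (R : pzRingType) (S T : R -> Prop) :
  ring_generated T ->
  ring_generated (fun x : ringquot S => exists2 u, T u & x = qproj S u).
Proof.
move=> genR P PT Pa Po Pm; elim/qprojW; apply: genR => [u Tu|u v Pu Pv|u Pu|u v Pu Pv].
- by apply: PT; exists u.
- by rewrite rmorphD; apply: Pa.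
- by rewrite rmorphN; apply: Po.
- by rewrite rmorphM; apply: Pm.
Qed.

Section BiquadUniversal.
Variables (D : pzRingType) (n : nat) (t : bq_data D n).

Lemma biquad_ind (P : biquad t -> Prop) :
  (forall d, P (bq_coef t d)) -> (forall i, P (bq_x t i)) ->
  (forall u v, P u -> P v -> P (u + v)) -> (forall u, P u -> P (- u)) ->
  (forall u v, P u -> P v -> P (u * v)) -> forall u, P u.
Proof.
move=> Pc Px; apply: (ringquot_generated (@free_ring_generated D 'I_n)).
by move=> u [_ [[d ->]|[i ->]] ->]; [apply: Pc | apply: Px].
Qed.

Lemma bq_x_coefC i d : bq_x t i * bq_coef t d = bq_coef t d * bq_x t i.
Proof.
rewrite /bq_x /bq_coef /= -!rmorphM; apply/qprojP/ideal_gen_sub.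
by left; exists i, d.
Qed.

Lemma bq_x_rel (i j : 'I_n) : (j < i)%N ->
  bq_x t i * bq_x t j = bq_coef t (bq_q t i j) * bq_x t j * bq_x t i
    + (\sum_(k < n) bq_coef t (bq_a t i j k) * bq_x t k + bq_coef t (bq_b t i j)).
Proof.
move=> ji; apply/subr0_eq; rewrite opprD addrA.
set r : biquad t := (X in X = 0).
have -> : r = qproj (bq_rel t) (fgen D i * fgen D j
    - fcoef 'I_n (bq_q t i j) * fgen D j * fgen D i
    - (\sum_(k < n) fcoef 'I_n (bq_a t i j k) * fgen D k + fcoef 'I_n (bq_b t i j))).
  rewrite !(rmorphB, rmorphD, rmorphM, rmorph_sum) {}/r !opprD !addrA.
  by congr (_ - _ - _ - _); apply: eq_bigr => k _; rewrite rmorphM.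
rewrite -(rmorph0 (qproj (bq_rel t))); apply/qprojP/ideal_gen_sub.
by right; exists i, j; split; rewrite // subr0.
Qed.

Variables (A : pzRingType) (f : {rmorphism D -> A}) (y : 'I_n -> A).
Hypothesis yfC : forall i d, y i * f d = f d * y i.
Hypothesis y_rel : forall i j : 'I_n, (j < i)%N ->
  y i * y j = f (bq_q t i j) * y j * y i
    + (\sum_(k < n) f (bq_a t i j k) * y k + f (bq_b t i j)).

Lemma biquad_lift : exists phi : {rmorphism biquad t -> A},
  (forall d, phi (bq_coef t d) = f d) /\ (forall i, phi (bq_x t i) = y i).
Proof.
have [h [hc hx]] := free_ring_lift f y.
have h0 r : bq_rel t r -> h r = 0.
  case=> [[i [d ->]]|[i [j [ji ->]]]].
    by rewrite rmorphB !rmorphM hc hx yfC subrr.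
  rewrite !(rmorphB, rmorphD, rmorphM, rmorph_sum) !hc !hx y_rel //.
  under [X in _ - (X + _)]eq_bigr do rewrite rmorphM hc hx.
  by rewrite addrAC addrK subrr.
have [phi phiE] := ringquot_lift h0.
by exists phi; split=> [d|i]; rewrite phiE.
Qed.

End BiquadUniversal.

Section UeaUniversal.
Variables (K : fieldType) (G : lieAlgType K) (Z : G).

Definition uea1_inj (x : G) : uea_mod1 Z := qproj (mod1_rel Z) (uea_inj x).

(** Convertible to [kscalar c], but spelled out through the two quotient maps so that their morphism
    laws can be applied. *)
Definition uea_scalar (c : K) : uea G :=
  qproj (@uea_rel K G) (qproj (@scalar_comm_rel K G) (fcoef G c)).

Lemma uea_inj_linear c (x y : G) :
  uea_inj (c *: x + y) = uea_scalar c * uea_inj x + uea_inj y.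
Proof.
have : qproj (@uea_rel K G) (falg_gen K (c *: x + y)
    - (kscalar c * falg_gen K x + falg_gen K y)) = qproj (@uea_rel K G) 0.
  by apply/qprojP; rewrite subr0; apply: ideal_gen_sub; left; exists c, x, y.
by rewrite rmorph0 rmorphB rmorphD rmorphM => /subr0_eq.
Qed.

Lemma uea_inj_br (x y : G) :
  uea_inj x * uea_inj y - uea_inj y * uea_inj x = uea_inj (lie_br x y).
Proof.
have : qproj (@uea_rel K G) (falg_gen K x * falg_gen K y
    - falg_gen K y * falg_gen K x - falg_gen K (lie_br x y))
      = qproj (@uea_rel K G) 0.
  by apply/qprojP; rewrite subr0; apply: ideal_gen_sub; right; exists x, y.
by rewrite rmorph0 !rmorphB !rmorphM => /subr0_eq.
Qed.

Definition uea1_scalar (c : K) : uea_mod1 Z := qproj (mod1_rel Z) (uea_scalar c).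

Lemma uea1_inj_linear c x y :
  uea1_inj (c *: x + y) = uea1_scalar c * uea1_inj x + uea1_inj y.
Proof.
rewrite /uea1_inj uea_inj_linear rmorphD rmorphM.
by congr (_ + _).
Qed.

Lemma uea1_inj_br x y :
  uea1_inj x * uea1_inj y - uea1_inj y * uea1_inj x = uea1_inj (lie_br x y).
Proof. by rewrite /uea1_inj -uea_inj_br rmorphB !rmorphM. Qed.

Lemma uea1_inj_Z : uea1_inj Z = 1.
Proof.
by rewrite -(rmorph1 (qproj (mod1_rel Z))); apply/qprojP/ideal_gen_sub.
Qed.

Lemma uea1_ind (P : uea_mod1 Z -> Prop) :
  (forall c, P (uea1_scalar c)) -> (forall x, P (uea1_inj x)) ->
  (forall u v, P u -> P v -> P (u + v)) -> (forall u, P u -> P (- u)) ->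
  (forall u v, P u -> P v -> P (u * v)) -> forall u, P u.
Proof.
move=> Pc Px; have := @free_ring_generated K G.
move=> /(@ringquot_generated _ (@scalar_comm_rel K G)).
move=> /(@ringquot_generated _ (@uea_rel K G)).
move=> /(@ringquot_generated _ (mod1_rel Z)); apply.
by move=> _ [_ [_ [_ [[c ->]|[x ->]] ->] ->] ->]; [apply: Pc | apply: Px].
Qed.

Variables (A : pzRingType) (k : {rmorphism K -> A}) (eta : G -> A).
Hypothesis k_eta : forall c x, k c * eta x = eta x * k c.
Hypothesis eta_linear : forall c x y, eta (c *: x + y) = k c * eta x + eta y.
Hypothesis eta_br : forall x y, eta x * eta y - eta y * eta x = eta (lie_br x y).
Hypothesis eta_Z : eta Z = 1.

Lemma uea1_lift : exists phi : {rmorphism uea_mod1 Z -> A},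
  (forall c, phi (uea1_scalar c) = k c) /\ (forall x, phi (uea1_inj x) = eta x).
Proof.
have [h [hc hx]] := free_ring_lift k eta.
have h0 r : scalar_comm_rel r -> h r = 0.
  by case=> c [x ->]; rewrite rmorphB !rmorphM hc hx k_eta subrr.
have [h1 h1E] := ringquot_lift h0.
have h1c c : h1 (kscalar c : free_alg K G) = k c by rewrite -hc -h1E.
have h1x x : h1 (falg_gen K x) = eta x by rewrite -hx -h1E.
have h10 r : uea_rel r -> h1 r = 0.
  case=> [[c [x [y ->]]]|[x [y ->]]].
    by rewrite !(rmorphB, rmorphD, rmorphM) h1c !h1x eta_linear subrr.
  by rewrite !(rmorphB, rmorphD, rmorphM) !h1x eta_br subrr.
have [h2 h2E] := ringquot_lift h10.
have h20 r : mod1_rel Z r -> h2 r = 0.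
  by move=> ->; rewrite rmorphB rmorph1 h2E h1x eta_Z subrr.
have [h3 h3E] := ringquot_lift h20.
exists h3; split=> [c|x].
  by rewrite h3E h2E h1E hc.
by rewrite h3E h2E h1x.
Qed.

End UeaUniversal.

Section TensorUniversal.
Variables (K : comPzRingType) (A B : kalgType K).

Lemma tensor_ind (P : tensor A B -> Prop) :
  P 0 -> (forall a b, P (tpure a b)) ->
  (forall u v, P u -> P v -> P (u + v)) -> (forall u, P u -> P (- u)) ->
  forall u, P u.
Proof.
move=> P0 Pp Pa Po; elim/tclassW; elim=> [|a b|s Ps t Pt|s Ps].
- exact: P0.
- exact: Pp.
- by rewrite tclassD; apply: Pa.
- by rewrite tclassN; apply: Po.
Qed.

Variables (R : pzRingType) (f : {rmorphism A -> R}) (g : {rmorphism B -> R}).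
Hypothesis fgC : forall a b, f a * g b = g b * f a.
Hypothesis fgK : forall c : K, f (kscalar c) = g (kscalar c).

Fixpoint teval (t : tterm A B) : R := match t with
  | TZero => 0
  | TPure a b => f a * g b
  | TAdd t1 t2 => teval t1 + teval t2
  | TOpp t1 => - teval t1
  end.

Lemma teval_tequiv s t : tequiv s t -> teval s = teval t.
Proof.
elim=> {s t} //=.
- by move=> s t u _ -> _ ->.
- by move=> s s' t t' _ -> _ ->.
- by move=> s s' _ ->.
- by move=> s t u; rewrite addrA.
- by move=> s t; rewrite addrC.
- by move=> s; rewrite add0r.
- by move=> s; rewrite addNr.
- by move=> a a' b; rewrite rmorphD mulrDl.
- by move=> a b b'; rewrite rmorphD mulrDr.
- by move=> c a b; rewrite !rmorphM -mulrA fgK.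
Qed.

Definition tdesc (x : tensor A B) : R := teval (trepr x).

Lemma tdesc_tclass t : tdesc (tclass t) = teval t.
Proof. exact/teval_tequiv/treprP. Qed.

Lemma tdesc_is_additive : additive tdesc.
Proof.
elim/tclassW=> s; elim/tclassW=> t.
by rewrite -tclassN -tclassD !tdesc_tclass.
Qed.

Lemma teval_tmul s t : teval (tmul s t) = teval s * teval t.
Proof.
elim: s => /= [|a b|s1 IH1 s2 IH2|s1 IH1]; first by rewrite mul0r.
- elim: t => /= [|a1 b1|t1 IH1 t2 IH2|t1 IH1].
  + by rewrite mulr0.
  + by rewrite !rmorphM -!mulrA; congr (_ * _); rewrite !mulrA fgC.
  + by rewrite IH1 IH2 mulrDr.
  + by rewrite IH1 mulrN.
- by rewrite IH1 IH2 mulrDl.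
- by rewrite IH1 mulNr.
Qed.

Lemma tdesc_is_monoid_morphism : monoid_morphism tdesc.
Proof.
split.
  by rewrite -[1]/(tclass (TPure 1 1)) tdesc_tclass /= !rmorph1 mulr1.
elim/tclassW=> s; elim/tclassW=> t.
by rewrite -[_ * _]/(ttimes _ _) ttimesE !tdesc_tclass teval_tmul.
Qed.

Lemma tensor_lift : exists phi : {rmorphism tensor A B -> R},
  forall a b, phi (tpure a b) = f a * g b.
Proof.
pose aP := GRing.isZmodMorphism.Build _ _ tdesc tdesc_is_additive.
pose mP := GRing.isMonoidMorphism.Build _ _ tdesc tdesc_is_monoid_morphism.
pose phi : {rmorphism tensor A B -> R} := HB.pack tdesc aP mP.
by exists phi => a b; apply: tdesc_tclass.
Qed.

End TensorUniversal.

(** * Lie type presentations and enveloping algebras *)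

Section SemilinearMaps.
Variables (K : fieldType) (G : lmodType K) (A : pzRingType).
Variables (k : {rmorphism K -> A}) (f : G -> A).
Hypothesis f_linear : forall c x y, f (c *: x + y) = k c * f x + f y.

Lemma semilinear0 : f 0 = 0.
Proof.
have := f_linear 1 0 0; rewrite scaler0 addr0 rmorph1 mul1r => f00.
by apply: (addrI (f 0)); rewrite -f00 addr0.
Qed.

Lemma semilinearZ c x : f (c *: x) = k c * f x.
Proof. by rewrite -[c *: x]addr0 f_linear semilinear0 addr0. Qed.

Lemma semilinearD x y : f (x + y) = f x + f y.
Proof. by rewrite -[x]scale1r f_linear scale1r rmorph1 mul1r. Qed.

Lemma semilinear_sum I (r : seq I) (c : I -> K) (v : I -> G) :
  f (\sum_(i <- r) c i *: v i) = \sum_(i <- r) k (c i) * f (v i).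
Proof.
elim: r => [|i r IH]; first by rewrite !big_nil semilinear0.
by rewrite !big_cons f_linear IH.
Qed.

End SemilinearMaps.

(* Stated for an abstract [U], because unification through the nested quotients
   of [uea_mod1 Z] is prohibitively slow. *)
Record uea1_spec (K : fieldType) (G : lieAlgType K) (Z : G) (U : kalgType K)
    (inj : G -> U) : Prop := Uea1Spec {
  uea1_linear : forall c x y, inj (c *: x + y) = kscalar c * inj x + inj y;
  uea1_br : forall x y, inj x * inj y - inj y * inj x = inj (lie_br x y);
  uea1_one : inj Z = 1;
  uea1_generated : forall P : U -> Prop,
    (forall c, P (kscalar c)) -> (forall x, P (inj x)) ->
    (forall u v, P u -> P v -> P (u + v)) -> (forall u, P u -> P (- u)) ->
    (forall u v, P u -> P v -> P (u * v)) -> forall u, P u;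
  uea1_universal : forall (A : pzRingType) (k : {rmorphism K -> A}) (eta : G -> A),
    (forall c x, k c * eta x = eta x * k c) ->
    (forall c x y, eta (c *: x + y) = k c * eta x + eta y) ->
    (forall x y, eta x * eta y - eta y * eta x = eta (lie_br x y)) ->
    eta Z = 1 ->
    exists phi : {rmorphism U -> A},
      (forall c, phi (kscalar c) = k c) /\ (forall x, phi (inj x) = eta x)
}.

Lemma uea_mod1_spec (K : fieldType) (G : lieAlgType K) (Z : G) :
  uea1_spec Z (uea1_inj Z).
Proof.
split.
- exact: uea1_inj_linear.
- exact: uea1_inj_br.
- exact: uea1_inj_Z.
- exact: uea1_ind.
- exact: uea1_lift.
Qed.

Section TensorRight.
Variables (K : comPzRingType) (A B : kalgType K).

Definition tensor_r (b : B) : tensor A B := tpure 1 b.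

Lemma tensor_r_is_additive : additive tensor_r.
Proof.
move=> b b'; apply: (addIr (tensor_r b')).
by rewrite subrK /tensor_r -tpureDr subrK.
Qed.
HB.instance Definition _ :=
  GRing.isZmodMorphism.Build B (tensor A B) tensor_r tensor_r_is_additive.

Lemma tensor_r_is_monoid_morphism : monoid_morphism tensor_r.
Proof. by split=> // b b'; rewrite /tensor_r tpureM mulr1. Qed.
HB.instance Definition _ :=
  GRing.isMonoidMorphism.Build B (tensor A B) tensor_r tensor_r_is_monoid_morphism.

Lemma tpureE a b : tpure a b = tensor_l B a * tensor_r b.
Proof. by rewrite /tensor_l /tensor_r tpureM mulr1 mul1r. Qed.

Lemma tensor_lrC a b : tensor_l B a * tensor_r b = tensor_r b * tensor_l B a.
Proof. by rewrite -tpureE /tensor_l /tensor_r tpureM mulr1 mul1r. Qed.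

Lemma tensor_lr_scalar c : tensor_l B (kscalar c) = tensor_r (kscalar c).
Proof. by rewrite /tensor_l /tensor_r -[kscalar c]mul1r tpureZ mulr1. Qed.

End TensorRight.

(** [Z] and the [e i] form a basis, with dual coordinates [z] and [w]. Giving the coordinates as
    functions covers both the explicit space K x K^n and a basis of an abstract [G] completing
    [Z]. *)
Record adapted_basis (K : fieldType) (G : lmodType K) n (Z : G) (e : 'I_n -> G)
    (z : G -> K) (w : G -> 'I_n -> K) : Prop := AdaptedBasis {
  basis_decomp : forall x, x = z x *: Z + \sum_i w x i *: e i;
  basis_z_linear : forall c x y, z (c *: x + y) = c * z x + z y;
  basis_w_linear : forall c x y i, w (c *: x + y) i = c * w x i + w y i;
  basis_zZ : z Z = 1;
  basis_wZ : forall i, w Z i = 0;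
  basis_ze : forall i, z (e i) = 0;
  basis_we : forall i j, w (e i) j = (i == j)%:R
}.

Section Bracket.
Variables (K : fieldType) (D : kalgType K) (n : nat) (t : bq_data D n).
Variables (a : 'I_n -> 'I_n -> 'I_n -> K) (b : 'I_n -> 'I_n -> K).
Hypothesis t_lie : lie_type_data t.
Hypothesis t_a : forall i j k : 'I_n, (j < i)%N -> bq_a t i j k = kscalar (a i j k).
Hypothesis t_b : forall i j : 'I_n, (j < i)%N -> bq_b t i j = kscalar (b i j).

Variables (G : lmodType K) (Z : G) (e : 'I_n -> G).
Variables (z : G -> K) (w : G -> 'I_n -> K).
Hypothesis basis : adapted_basis Z e z w.

Lemma adapted_ind (P : G -> Prop) :
  (forall c x y, P x -> P y -> P (c *: x + y)) -> P Z -> (forall i, P (e i)) ->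
  forall x, P x.
Proof.
move=> Plin PZ Pe x; rewrite (basis_decomp basis x) addrC.
have P0 : P 0 by rewrite -(addNr Z) -scaleN1r; apply: Plin.
elim: (index_enum 'I_n) => [|i r IH].
  by rewrite big_nil addrC; apply: Plin.
by rewrite big_cons -addrA; apply: Plin.
Qed.

Definition bq_scalar : K -> biquad t := bq_coef t \o kscalar.
HB.instance Definition _ := GRing.RMorphism.on bq_scalar.

Lemma bq_scalarC c u : bq_scalar c * u = u * bq_scalar c.
Proof.
elim/biquad_ind: u => [d|i|u v IHu IHv|u IHu|u v IHu IHv].
- by rewrite /bq_scalar /= -!rmorphM kscalar_central.
- by rewrite /bq_scalar /= bq_x_coefC.
- by rewrite mulrDr mulrDl IHu IHv.
- by rewrite mulrN mulNr IHu.
- by rewrite mulrA IHu -mulrA IHv mulrA.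
Qed.

(** The linear map that sends [Z] to 1 and each [e i] to x_i. *)
Definition bq_eta (x : G) : biquad t :=
  bq_scalar (z x) + \sum_i bq_scalar (w x i) * bq_x t i.

Lemma bq_eta_linear c x y : bq_eta (c *: x + y) = bq_scalar c * bq_eta x + bq_eta y.
Proof.
rewrite /bq_eta (basis_z_linear basis) rmorphD rmorphM mulrDr addrACA.
congr (_ + _); rewrite mulr_sumr -big_split; apply: eq_bigr => i _ /=.
by rewrite (basis_w_linear basis) rmorphD rmorphM mulrDl mulrA.
Qed.

Lemma bq_eta_Z : bq_eta Z = 1.
Proof.
rewrite /bq_eta (basis_zZ basis) rmorph1 big1 ?addr0 // => i _.
by rewrite (basis_wZ basis) rmorph0 mul0r.
Qed.

Lemma bq_eta_e i : bq_eta (e i) = bq_x t i.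
Proof.
rewrite /bq_eta (basis_ze basis) rmorph0 add0r (bigD1 i) //= (basis_we basis) eqxx.
rewrite rmorph1 mul1r big1 ?addr0 // => j ji.
by rewrite (basis_we basis) eq_sym (negbTE ji) rmorph0 mul0r.
Qed.

(** Both sides are bilinear, so basis vectors suffice: with [Z] both sides vanish, since 1 is
    central, and the pairs of [e i] are the defining relations. The Jacobi identity is not among the
    hypotheses because it will be deduced from this lemma. *)
Lemma bq_eta_comm (br : G -> G -> G) :
  (forall c x y v, br (c *: x + y) v = c *: br x v + br y v) ->
  (forall c x y v, br v (c *: x + y) = c *: br v x + br v y) ->
  (forall x, br Z x = 0) -> (forall x, br x Z = 0) ->
  (forall i, br (e i) (e i) = 0) -> (forall i j, br (e i) (e j) = - br (e j) (e i)) ->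
  (forall i j : 'I_n, (j < i)%N ->
     br (e i) (e j) = \sum_k a i j k *: e k + b i j *: Z) ->
  forall x y, bq_eta x * bq_eta y - bq_eta y * bq_eta x = bq_eta (br x y).
Proof.
move=> brl brr brZl brZr bree brC br_e.
move: bq_eta bq_eta_linear bq_eta_Z bq_eta_e => eta eta_lin eta_Z eta_e.
have eta0 := semilinear0 eta_lin.
have etaD := semilinearD eta_lin.
have etaZ := semilinearZ eta_lin.
have comm_lin c x y v :
    eta x * eta v - eta v * eta x = eta (br x v) ->
    eta y * eta v - eta v * eta y = eta (br y v) ->
    eta (c *: x + y) * eta v - eta v * eta (c *: x + y)
      = eta (br (c *: x + y) v).
  move=> Ex Ey; rewrite brl !eta_lin mulrDl mulrDr -Ex -Ey mulrBr !mulrA.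
  by rewrite -bq_scalarC opprD addrACA.
have comm_ltr (i j : 'I_n) : (j < i)%N ->
    eta (e i) * eta (e j) - eta (e j) * eta (e i) = eta (br (e i) (e j)).
  move=> ji; rewrite br_e // etaD etaZ (semilinear_sum eta_lin) eta_Z mulr1.
  rewrite !eta_e bq_x_rel // t_lie // rmorph1 mul1r addrAC subrr add0r.
  rewrite t_b //; congr (_ + _); apply: eq_bigr => k _.
  by rewrite eta_e t_a.
have comm_sym x y : br x y = - br y x ->
    eta y * eta x - eta x * eta y = eta (br y x) ->
    eta x * eta y - eta y * eta x = eta (br x y).
  by move=> -> E; rewrite -scaleN1r etaZ -E rmorphN1 mulN1r opprB.
have comm_Z x : eta x * eta Z - eta Z * eta x = eta (br x Z).
  by rewrite brZr eta0 eta_Z mulr1 mul1r subrr.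
have comm_Z' x : eta Z * eta x - eta x * eta Z = eta (br Z x).
  by rewrite brZl eta0 eta_Z mulr1 mul1r subrr.
move=> x y; elim/adapted_ind: x => [c x x' Ex Ex'||i];
  [exact: comm_lin|exact: comm_Z'|].
elim/adapted_ind: y => [c y y' Ey Ey'||j]; [|exact: comm_Z|].
  rewrite brr !eta_lin mulrDl mulrDr -Ey -Ey' mulrBr !mulrA.
  by rewrite -bq_scalarC opprD addrACA.
case: (ltngtP i j) => [ij|ji|/val_inj ->].
- by apply: comm_sym; [apply: brC | apply: comm_ltr].
- exact: comm_ltr.
- by rewrite bree eta0 subrr.
Qed.

End Bracket.

Section TensorIso.
Variables (K : fieldType) (D : kalgType K) (n : nat) (t : bq_data D n).
Variables (a : 'I_n -> 'I_n -> 'I_n -> K) (b : 'I_n -> 'I_n -> K).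
Hypothesis t_lie : lie_type_data t.
Hypothesis t_a : forall i j k : 'I_n, (j < i)%N -> bq_a t i j k = kscalar (a i j k).
Hypothesis t_b : forall i j : 'I_n, (j < i)%N -> bq_b t i j = kscalar (b i j).

Variables (G : lieAlgType K) (Z : G) (e : 'I_n -> G).
Variables (z : G -> K) (w : G -> 'I_n -> K).
Hypothesis basis : adapted_basis Z e z w.
Hypothesis Z_central : lie_center Z.
Hypothesis br_e : forall i j : 'I_n, (j < i)%N ->
  lie_br (e i) (e j) = \sum_k a i j k *: e k + b i j *: Z.

Variables (U : kalgType K) (inj : G -> U).
Hypothesis U_spec : uea1_spec Z inj.

Lemma lie_brC (x y : G) : lie_br x y = - lie_br y x.
Proof.
apply/eqP; rewrite -addr_eq0; apply/eqP.
by have := lie_brxx (x + y); rewrite lie_brDl !lie_brDr !lie_brxx add0r addr0.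
Qed.

Lemma eta_comm x y :
  bq_eta t z w x * bq_eta t z w y - bq_eta t z w y * bq_eta t z w x
    = bq_eta t z w (lie_br x y).
Proof.
apply: (bq_eta_comm t_lie t_a t_b basis).
- by move=> c u v x'; rewrite lie_brDl lie_brZl.
- by move=> c u v x'; rewrite lie_brDr lie_brZr.
- exact: Z_central.
- by move=> u; rewrite lie_brC Z_central oppr0.
- by move=> i; apply: lie_brxx.
- by move=> i j; apply: lie_brC.
- exact: br_e.
Qed.

Lemma tensor_iso : iso_over (bq_coef t) (tensor_l U : D -> tensor D U).
Proof.
have inj_lin := uea1_linear U_spec.
have inj1 := uea1_one U_spec.
pose injr := (@tensor_r _ D U) \o inj.
have lrs c : (tensor_l U : {rmorphism D -> tensor D U}) (kscalar c)
             = tensor_r D (kscalar c) := tensor_lr_scalar D U c.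
have [phi [phi_c phi_x]] : exists phi : {rmorphism biquad t -> tensor D U},
    (forall d, phi (bq_coef t d) = tensor_l U d)
    /\ (forall i, phi (bq_x t i) = injr (e i)).
  apply: biquad_lift => [i d|i j ji]; first by rewrite tensor_lrC.
  rewrite t_lie // rmorph1 mul1r addrC; apply/subr0_eq.
  rewrite opprD addrA addrAC -!rmorphM -rmorphB (uea1_br U_spec) br_e //.
  rewrite (semilinearD inj_lin) (semilinear_sum inj_lin) (semilinearZ inj_lin) inj1.
  rewrite mulr1 rmorphD rmorph_sum t_b //. rewrite lrs.
  under [X in _ - (X + _)]eq_bigr do rewrite t_a // lrs -rmorphM.
  by rewrite subrr.
(* The inverse is assembled from [bq_coef] on [D] and [g] on [U]; the tensor product requires their
   images to commute and to agree on [K]. *)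
have [g [g_c g_x]] := uea1_universal U_spec
  (fun c x => bq_scalarC c (bq_eta t z w x)) (bq_eta_linear t basis) eta_comm
  (bq_eta_Z t basis).
have gC d u : bq_coef t d * g u = g u * bq_coef t d.
  elim/(uea1_generated U_spec): u => [c|x|u v IHu IHv|u IHu|u v IHu IHv].
  - by rewrite g_c -bq_scalarC.
  - rewrite g_x /bq_eta mulrDr mulrDl -bq_scalarC mulr_sumr mulr_suml.
    congr (_ + _); apply: eq_bigr => i _.
    by rewrite mulrA -bq_scalarC -!mulrA bq_x_coefC.
  - by rewrite rmorphD mulrDr mulrDl IHu IHv.
  - by rewrite rmorphN mulrN mulNr IHu.
  - by rewrite rmorphM mulrA IHu -[LHS]mulrA IHv mulrA.
have [psi psiE] := tensor_lift gC (fun c => esym (g_c c)).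
exists phi; split=> //; exists psi.
  elim/biquad_ind=> [d|i|u v IHu IHv|u IHu|u v IHu IHv].
  - by rewrite phi_c psiE rmorph1 mulr1.
  - by rewrite phi_x psiE rmorph1 mul1r g_x (bq_eta_e t basis).
  - by rewrite !rmorphD IHu IHv.
  - by rewrite !rmorphN IHu.
  - by rewrite !rmorphM IHu IHv.
(* On pure tensors the second composite reduces to this identity, which is checked on the generators
   of [U]. *)
have phi_g u : phi (g u) = tensor_r D u.
  elim/(uea1_generated U_spec): u => [c|x|u v IHu IHv|u IHu|u v IHu IHv].
  - by rewrite g_c phi_c tensor_lr_scalar.
  - rewrite g_x /bq_eta rmorphD phi_c rmorph_sum tensor_lr_scalar.
    rewrite [in RHS](basis_decomp basis x) (semilinearD inj_lin).
    rewrite (semilinear_sum inj_lin) (semilinearZ inj_lin) inj1 mulr1.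
    rewrite rmorphD rmorph_sum; congr (_ + _); apply: eq_bigr => i _.
    by rewrite !rmorphM phi_c phi_x tensor_lr_scalar.
  - by rewrite !rmorphD IHu IHv.
  - by rewrite !rmorphN IHu.
  - by rewrite !rmorphM IHu IHv.
elim/tensor_ind=> [|d u|u v IHu IHv|u IHu].
- by rewrite !rmorph0.
- by rewrite psiE rmorphM phi_c phi_g tpureE.
- by rewrite !rmorphD IHu IHv.
- by rewrite !rmorphN IHu.
Qed.

End TensorIso.

(** * Kernels of wide matrices *)

Section McCoy.
Variables (C : comPzRingType) (I J : finType) (c : J -> I -> C).

(** The selections may repeat rows or columns; a repetition only makes the determinant zero, so
    injectivity need not be imposed. *)
Definition has_minor r := exists (f : 'I_r -> I) (g : 'I_r -> J),
  \det (\matrix_(p, q) c (g p) (f q)) != 0.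

Lemma has_minor_le r : has_minor r -> (r <= #|J|)%N.
Proof.
case=> f [g]; apply: contraR; rewrite -ltnNge => rJ; apply/eqP.
have /injectivePn[p [q pq gpq]] : ~~ injectiveb g.
  by apply: contraL rJ => /injectiveP /leq_card; rewrite card_ord -leqNgt.
by apply: (determinant_alternate pq) => k; rewrite !mxE gpq.
Qed.

(* The cofactors along an extra row, added to a nonzero minor of maximal size,
   give the kernel vector. *)
Lemma wide_matrix_kernel : (1 : C) != 0 -> (#|J| < #|I|)%N ->
  exists v : I -> C, (exists i, v i != 0) /\ forall j, \sum_i c j i * v i = 0.
Proof.
move=> C1 JI.
have [r [[f [g fg]] rmax]] : exists r, has_minor r /\ ~ has_minor r.+1.
  (* The empty minor equals 1, which is nonzero, so a maximal size exists. *)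
  have h0 : exists r, `[< has_minor r >].
    have F (T : Type) : 'I_0 -> T by case.
    exists 0%N; apply/asboolP; exists (F I), (F J).
    by rewrite det_mx00.
  have hb r : `[< has_minor r >] -> (r <= #|J|)%N by move=> /asboolP /has_minor_le.
  case: (ex_maxnP h0 hb) => r /asboolP hr rmax; exists r; split=> // hr1.
  by have := rmax r.+1 (asboolT hr1); rewrite ltnn.
(* A column is left over because [r] is at most [#|J|], which is less than [#|I|]. *)
have [i0 i0f] : exists i0, forall q, f q != i0.
  have /subsetPn[i0 _ i0f] : ~~ ([set: I] \subset f @: [set: 'I_r]).
    apply: contraL JI => /subset_leq_card; rewrite cardsT -leqNgt => h.
    apply: leq_trans h _; apply: leq_trans (leq_imset_card _ _) _.
    by rewrite cardsT card_ord; apply: has_minor_le; exists f, g.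
  exists i0 => q; apply: contraNneq i0f => <-.
  by apply: imset_f; rewrite inE.
pose f' (q : 'I_r.+1) := if unlift ord0 q is Some q' then f q' else i0.
pose g' j (p : 'I_r.+1) := if unlift ord0 p is Some p' then g p' else j.
pose M j := \matrix_(p, q) c (g' j p) (f' q).
have M_cof j j' q : cofactor (M j) ord0 q = cofactor (M j') ord0 q.
  rewrite /cofactor; congr (_ * \det _); apply/matrixP => p p'.
  by rewrite !mxE /g' liftK.
have [j0 _|J0] := pickP J; last first.
  exists (fun i => 1); split; first by exists i0.
  by move=> j; have := J0 j.
(* Row 0 of [M j] is the added row [j], and cofactors along it do not see it, so the choice of [j0]
   is immaterial. Summing over the fibre of [f'] avoids proving [f'] injective. *)
pose v i := \sum_(q | f' q == i) cofactor (M j0) ord0 q.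
exists v; split.
  (* Only position 0 maps to [i0], and its cofactor is the chosen nonzero minor. *)
  exists i0; rewrite /v (bigD1 ord0) /=; last by rewrite /f' unlift_none.
  rewrite big1 ?addr0; last first.
    move=> q /andP[fq q0]; case: (unliftP ord0 q) fq q0 => [q' ->|->];
      last by rewrite eqxx.
    by rewrite /f' liftK (negbTE (i0f _)).
  rewrite /cofactor addn0 expr0 mul1r.
  apply: contraNneq fg => <-; apply/eqP; congr (\det _).
  by apply/matrixP => p q; rewrite !mxE /g' /f' !liftK.
(* This is a minor of size [r.+1], zero by maximality; its expansion along row 0 is the required
   equation. *)
move=> j; have detM : \det (M j) = 0.
  by apply/eqP; apply: contra_notT rmax => dM; exists f', (g' j).
rewrite -[RHS]detM (expand_det_row _ ord0).
under eq_bigr do rewrite mulr_sumr.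
rewrite (exchange_big_dep xpredT) //=; apply: eq_bigr => q _.
rewrite (big_pred1 (f' q)) => [|i]; last by rewrite /= eq_sym.
rewrite (M_cof j j0) mxE.
by congr (c _ _ * _); rewrite /g' unlift_none.
Qed.

End McCoy.

Section Center.
Variable D : pzRingType.

Definition centerb : {pred D} := [pred z | `[< ring_central z >]].

Lemma centerb_subring : subring_closed centerb.
Proof.
split=> [|u v /asboolP uC /asboolP vC|u v /asboolP uC /asboolP vC]; apply/asboolP => r.
- by rewrite mul1r mulr1.
- by rewrite mulrBl mulrBr uC vC.
- by rewrite -mulrA vC mulrA uC mulrA.
Qed.

Record center := Center { center_val :> D; center_valP : center_val \in centerb }.
HB.instance Definition _ := [isSub for center_val].
HB.instance Definition _ := [Choice of center by <:].
HB.instance Definition _ := 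
  GRing.SubChoice_isSubPzRing.Build D centerb center centerb_subring.

Lemma center_mulC : commutative (@GRing.mul center).
Proof.
move=> u v; apply: val_inj; rewrite !rmorphM /=.
by case: u => u /= /asboolP ->.
Qed.
HB.instance Definition _ := GRing.PzRing_hasCommutativeMul.Build center center_mulC.

(** Centrality is essential: over the free algebra on x and y the row (x, y) kills no nonzero
    column. With central entries the kernel vector is found over the commutative ring [center]. *)
Lemma central_matrix_kernel (I J : finType) (c : J -> I -> D) :
  (1 : D) != 0 -> (#|J| < #|I|)%N -> (forall j i, ring_central (c j i)) ->
  exists v : I -> D, (exists i, v i != 0) /\ forall j, \sum_i c j i * v i = 0.
Proof.
move=> D1 JI cC.
pose c' j i : center := Center (asboolT (cC j i)).
have C1 : (1 : center) != 0.
  by apply: contraNneq D1 => /(congr1 center_val) /= ->.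
have [v [[i vi] v0]] := wide_matrix_kernel c' C1 JI.
exists (fun i => center_val (v i)); split.
  by exists i; apply: contraNneq vi => vi0; apply/eqP/val_inj.
move=> j; transitivity (\val (\sum_k c' j k * v k)); last by rewrite v0.
by rewrite rmorph_sum; apply: eq_bigr => k _; rewrite rmorphM.
Qed.

End Center.

(** * Straightening words *)

Section WordSpan.
Variables (D A : pzRingType) (f : {rmorphism D -> A}) (L : finType) (y : L -> A).
Hypothesis yfC : forall i d, y i * f d = f d * y i.

Definition word (w : seq L) : A := \prod_(i <- w) y i.

(** The m-th piece of the filtration of [A] by word length, with coefficients in [D]. *)
Inductive wspan (m : nat) : A -> Prop :=
| wspan_word d w : (size w <= m)%N -> wspan m (f d * word w)
| wspan0 : wspan m 0
| wspanD u v : wspan m u -> wspan m v -> wspan m (u + v).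

Lemma word_cat w w' : word (w ++ w') = word w * word w'.
Proof. by rewrite /word big_cat. Qed.

Lemma word1 i : word [:: i] = y i.
Proof. exact: big_seq1. Qed.

Lemma word_fC w d : word w * f d = f d * word w.
Proof.
rewrite /word; elim: w => [|i w IH]; first by rewrite big_nil mulr1 mul1r.
by rewrite big_cons -mulrA IH !mulrA yfC.
Qed.

Lemma wspan_widen m m' u : (m <= m')%N -> wspan m u -> wspan m' u.
Proof.
move=> mm'; elim=> {u} [d w wm||u v _ IHu _ IHv]; first 1 last.
- exact: wspan0.
- exact: wspanD.
- by apply: wspan_word; apply: leq_trans mm'.
Qed.

Lemma wspanMl m d u : wspan m u -> wspan m (f d * u).
Proof.
elim=> {u} [d' w wm||u v _ IHu _ IHv].
- by rewrite mulrA -rmorphM; apply: wspan_word.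
- by rewrite mulr0; apply: wspan0.
- by rewrite mulrDr; apply: wspanD.
Qed.

Lemma wspanN m u : wspan m u -> wspan m (- u).
Proof. by rewrite -mulN1r -(rmorphN1 f); apply: wspanMl. Qed.

Lemma wspan_sum m I (r : seq I) (P : pred I) (F : I -> A) :
  (forall i, P i -> wspan m (F i)) -> wspan m (\sum_(i <- r | P i) F i).
Proof.
move=> PF; apply: (big_ind (wspan m)); [exact: wspan0 | exact: wspanD | exact: PF].
Qed.

Lemma wspanM m m' u v : wspan m u -> wspan m' v -> wspan (m + m') (u * v).
Proof.
move=> Wu Wv; elim: Wu => {u} [d w wm||u u' _ IHu _ IHu'].
- elim: Wv => {v} [d' w' wm'||v v' _ IHv _ IHv'].
  + rewrite -mulrA [word w * _]mulrA word_fC -!mulrA -word_cat mulrA -rmorphM.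
    by apply: wspan_word; rewrite size_cat leq_add.
  + by rewrite mulr0; apply: wspan0.
  + by rewrite mulrDr; apply: wspanD.
- by rewrite mul0r; apply: wspan0.
- by rewrite mulrDl; apply: wspanD.
Qed.

Lemma wspan_coef d : wspan 0 (f d).
Proof. by rewrite -[f d]mulr1 -(big_nil 1 *%R xpredT y); apply: wspan_word. Qed.

Lemma wspan_letters w : wspan (size w) (word w).
Proof. by rewrite -[word w]mul1r -(rmorph1 f); apply: wspan_word. Qed.

Lemma wspan_gen i : wspan 1 (y i).
Proof. by rewrite -word1; apply: (wspan_letters [:: i]). Qed.

Lemma wspanX m u k : wspan m u -> wspan (k * m) (u ^+ k).
Proof.
move=> Wu; elim: k => [|k IH]; first by rewrite expr0 -(rmorph1 f); apply: wspan_coef.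
by rewrite exprS mulSn; apply: wspanM.
Qed.

Lemma wspan_prod m I (r : seq I) (F : I -> A) :
  (forall i, wspan m (F i)) -> wspan (size r * m) (\prod_(i <- r) F i).
Proof.
move=> WF; elim: r => [|i r IH].
  by rewrite big_nil -(rmorph1 f); apply: wspan_coef.
by rewrite big_cons mulSn; apply: wspanM.
Qed.

Section Straightening.
Hypothesis comm : forall i j, wspan 1 (y i * y j - y j * y i).

(** Commutation with [y i] is a derivation, and by [comm] it turns each letter into an element of
    degree at most 1, so one degree is lost. *)
Lemma word_gen_comm i w : wspan (size w) (y i * word w - word w * y i).
Proof.
elim: w => [|j w IH].
  by rewrite /word big_nil mulr1 mul1r subrr; apply: wspan0.
rewrite -cat1s word_cat size_cat word1.
have -> : y i * (y j * word w) - y j * word w * y i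
    = (y i * y j - y j * y i) * word w + y j * (y i * word w - word w * y i).
  by rewrite mulrBl mulrBr !mulrA addrA subrK.
by apply: wspanD; apply: wspanM => //;
  [apply: wspan_letters | apply: wspan_gen].
Qed.

Lemma word_comm w w' :
  wspan (size w + size w').-1 (word w * word w' - word w' * word w).
Proof.
elim: w => [|i w IH] /=.
  by rewrite /word big_nil mulr1 mul1r subrr; apply: wspan0.
rewrite -cat1s word_cat word1.
have -> : y i * word w * word w' - word w' * (y i * word w)
    = y i * (word w * word w' - word w' * word w)
      + (y i * word w' - word w' * y i) * word w.
  by rewrite mulrBl mulrBr !mulrA addrA subrK.
apply: wspanD; last first.
  by rewrite addnC; apply: wspanM; [apply: word_gen_comm | apply: wspan_letters].
(* With an empty tail the term is 0. This case is split off because 1 plus the truncated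
   [(size w').-1] is too large a bound when [w'] is empty. *)
case: w IH => [|j w] IH.
  by rewrite /word big_nil mulr1 mul1r subrr mulr0; apply: wspan0.
by rewrite /= addSn -add1n; apply: wspanM; first exact: wspan_gen.
Qed.

(** Permutations are generated by exchanges of two leading blocks, and [word_comm] bounds the effect
    of each exchange. *)
Lemma word_perm w w' : perm_eq w w' -> wspan (size w).-1 (word w - word w').
Proof.
move=> ww'; rewrite (perm_size ww').
have: wspan (size w').-1 (word w' - word w').
  by rewrite subrr; apply: wspan0.
move: ww'; rewrite perm_sym.
(* The premise keeps the length of every intermediate word equal to that of [w']. *)
pose P v := perm_eq v w' -> wspan (size w').-1 (word v - word w').
suff: forall v v', perm_eq v v' -> P v -> P v'.
  move=> H pww' W0; apply: (H _ _ pww') => //.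
  by rewrite perm_sym.
apply: catCA_perm_ind => v1 v2 v3 IH pv.
have pv' : perm_eq (v1 ++ v2 ++ v3) w'.
  by apply: perm_trans pv; rewrite perm_catCA.
rewrite -[word _](subrK (word (v1 ++ v2 ++ v3))) -addrA; apply: wspanD; last exact: IH.
rewrite !word_cat !mulrA -mulrBl.
case: v1 IH pv pv' => [|i v1] IH pv pv'.
  by rewrite /word big_nil mulr1 mul1r subrr mul0r; apply: wspan0.
apply: (@wspan_widen ((size v2 + size (i :: v1)).-1 + size v3)).
  by rewrite -(perm_size pv') !size_cat /= addnS /= addnA (addnC (size v1)).
by apply: wspanM; [apply: word_comm | apply: wspan_letters].
Qed.

(** Bounding each exponent separately, and not the total length, gives a finite index type with
    exactly (M+1)^#|L| elements. *)
Definition sorted_word M (be : {ffun L -> 'I_M.+1}) : seq L :=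
  flatten [seq nseq (be i) i | i <- enum L].

Lemma count_sorted_word M (be : {ffun L -> 'I_M.+1}) i :
  count_mem i (sorted_word be) = be i.
Proof.
rewrite /sorted_word count_flatten -map_comp sumnE big_map big_enum /=.
rewrite (bigD1 i) //= count_nseq /= eqxx mul1n big1 ?addn0 // => j ji.
by rewrite count_nseq /= (negbTE ji) mul0n.
Qed.

Lemma wspan_sorted M m u : (m <= M)%N -> wspan m u ->
  exists g : {ffun L -> 'I_M.+1} -> D, u = \sum_be f (g be) * word (sorted_word be).
Proof.
pose nf v := exists g : {ffun L -> 'I_M.+1} -> D,
  v = \sum_be f (g be) * word (sorted_word be).
have nfD a b : nf a -> nf b -> nf (a + b).
  move=> [g ->] [h ->]; exists (fun be => g be + h be); rewrite -big_split.
  by apply: eq_bigr => be _; rewrite rmorphD mulrDl.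
have nfMl d a : nf a -> nf (f d * a).
  move=> [g ->]; exists (fun be => d * g be); rewrite mulr_sumr.
  by apply: eq_bigr => be _; rewrite rmorphM mulrA.
rewrite -/(nf u).
have [N] := ubnP m; elim: N m u => // N IH m u /ltnSE mN mM.
elim=> {u} [d w wm||u v _ IHu _ IHv]; last exact: nfD; last first.
  by exists (fun _ => 0); rewrite big1 // => be _; rewrite rmorph0 mul0r.
apply: nfMl.
(* [inord] is faithful here: each count is at most the length of [w], hence at most [M]. *)
pose be : {ffun L -> 'I_M.+1} := [ffun i => inord (count_mem i w)].
have pw : perm_eq w (sorted_word be).
  apply/allP => i _; apply/eqP; rewrite count_sorted_word ffunE inordK //.
  by rewrite ltnS (leq_trans (count_size _ _)) // (leq_trans wm).
rewrite -[word w](subrK (word (sorted_word be))); apply: nfD; last first.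
  exists (fun be' => (be' == be)%:R).
  rewrite (bigD1 be) //= eqxx rmorph1 mul1r big1 ?addr0 // => be' /negbTE ->.
  by rewrite rmorph0 mul0r.
(* The degree of the empty word cannot drop, but that word is already sorted. *)
case: (posnP (size w)) => [/size0nil w0|w0]; last first.
  apply: (IH (size w).-1); last exact: word_perm.
    by rewrite prednK // (leq_trans wm).
  by rewrite (leq_trans (leq_pred _)) // (leq_trans wm).
have /perm_nilP -> : perm_eq (sorted_word be) [::] by rewrite -w0 perm_sym.
by exists (fun _ => 0); rewrite w0 subrr big1 // => be' _; rewrite rmorph0 mul0r.
Qed.

End Straightening.

End WordSpan.

(** * Growth of algebras with a PBW basis *)

Section PBWExpansion.
Variables (D : pzRingType) (n : nat) (s : bq_data D n).
Local Notation mon := {ffun 'I_n -> nat}.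

(** The coefficients form a total function of finite support, so expansions with different supports
    can be added and compared pointwise. *)
Definition pbw_expansion (u : biquad s) (k : mon -> D) :=
  exists m : seq mon, [/\ uniq m, forall al, al \notin m -> k al = 0 &
    u = \sum_(al <- m) bq_coef s (k al) * bq_monom s al].

Lemma big_uniq_widen (V : nmodType) (I : eqType) (m m' : seq I) (F : I -> V) :
  uniq m -> uniq m' -> {subset m <= m'} -> (forall i, i \notin m -> F i = 0) ->
  \sum_(i <- m) F i = \sum_(i <- m') F i.
Proof.
move=> Um Um' mm' F0; rewrite [RHS](bigID (mem m)) /= [X in _ + X]big1 // addr0.
rewrite -[RHS]big_filter; apply: perm_big; apply: uniq_perm => //.
  exact: filter_uniq.
by move=> i; rewrite mem_filter andb_idr //; apply: mm'.
Qed.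

Lemma pbw_expansion_widen u k (m0 : seq mon) : pbw_expansion u k ->
  exists m : seq mon, [/\ uniq m, {subset m0 <= m}, forall al, al \notin m -> k al = 0 &
    u = \sum_(al <- m) bq_coef s (k al) * bq_monom s al].
Proof.
case=> m [Um k0 ->]; have mU : {subset m <= undup (m ++ m0)}.
  by move=> al am; rewrite mem_undup mem_cat am.
exists (undup (m ++ m0)); split.
- exact: undup_uniq.
- by move=> al am; rewrite mem_undup mem_cat am orbT.
- by move=> al am; apply: k0; apply: contra am; apply: mU.
- apply: big_uniq_widen => //; first exact: undup_uniq.
  by move=> al /k0 ->; rewrite rmorph0 mul0r.
Qed.

Lemma pbw_expansion2 u v k l : pbw_expansion u k -> pbw_expansion v l ->
  exists m : seq mon, [/\ uniq m, forall al, al \notin m -> k al = 0 /\ l al = 0,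
    u = \sum_(al <- m) bq_coef s (k al) * bq_monom s al &
    v = \sum_(al <- m) bq_coef s (l al) * bq_monom s al].
Proof.
move=> Eu [m [Um l0 ->]]; have [m' [Um' mm' k0 ->]] := pbw_expansion_widen m Eu.
exists m'; split=> //.
  by move=> al am'; split; [apply: k0 | apply: l0; apply: contra am'; apply: mm'].
by apply: big_uniq_widen => // al /l0 ->; rewrite rmorph0 mul0r.
Qed.

Lemma pbw_expansionD u v k l : pbw_expansion u k -> pbw_expansion v l ->
  pbw_expansion (u + v) (fun al => k al + l al).
Proof.
move=> Eu Ev; have [m [Um kl0 -> ->]] := pbw_expansion2 Eu Ev.
exists m; split=> //; first by move=> al /kl0 [-> ->]; rewrite addr0.
by rewrite -big_split; apply: eq_bigr => al _; rewrite rmorphD mulrDl.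
Qed.

Lemma pbw_expansionMl d u k : pbw_expansion u k ->
  pbw_expansion (bq_coef s d * u) (fun al => d * k al).
Proof.
move=> [m [Um k0 ->]]; exists m; split=> //; first by move=> al /k0 ->; rewrite mulr0.
by rewrite mulr_sumr; apply: eq_bigr => al _; rewrite rmorphM mulrA.
Qed.

Lemma pbw_expansion0 : pbw_expansion 0 (fun _ => 0).
Proof. by exists [::]; rewrite big_nil. Qed.

Lemma pbw_expansion_sum (I : finType) (u : I -> biquad s) (k : I -> mon -> D) :
  (forall i, pbw_expansion (u i) (k i)) ->
  pbw_expansion (\sum_i u i) (fun al => \sum_i k i al).
Proof.
move=> Eu; elim: (index_enum I) => [|i r IH].
  rewrite big_nil (_ : (fun al => _) = fun _ => 0); first exact: pbw_expansion0.
  by apply: funext => al; rewrite big_nil.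
rewrite big_cons (_ : (fun al => _) = fun al => k i al + \sum_(j <- r) k j al).
  exact: pbw_expansionD.
by apply: funext => al; rewrite big_cons.
Qed.

Lemma bq_monom_coefC al d : bq_monom s al * bq_coef s d = bq_coef s d * bq_monom s al.
Proof.
rewrite /bq_monom; apply: (big_ind (fun u => u * bq_coef s d = bq_coef s d * u)).
- by rewrite mulr1 mul1r.
- by move=> u v uC vC; rewrite -mulrA vC !mulrA uC.
- by move=> i _; apply/commr_sym/commrX/esym/bq_x_coefC.
Qed.

Lemma pbw_expansionMr d u k : pbw_expansion u k ->
  pbw_expansion (u * bq_coef s d) (fun al => k al * d).
Proof.
move=> [m [Um k0 ->]]; exists m; split=> //; first by move=> al /k0 ->; rewrite mul0r.
rewrite mulr_suml; apply: eq_bigr => al _.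
by rewrite rmorphM -!mulrA bq_monom_coefC.
Qed.

Lemma pbw_expansion_monom al : pbw_expansion (bq_monom s al) (fun be => (be == al)%:R).
Proof.
exists [:: al]; split=> //; first by move=> be; rewrite inE => /negbTE ->.
by rewrite big_seq1 eqxx rmorph1 mul1r.
Qed.

Hypothesis s_PBW : has_PBW_basis s.

Lemma pbw_expansion_uniq u k l : pbw_expansion u k -> pbw_expansion u l -> k =1 l.
Proof.
move=> Ek El al; have [m [Um kl0 uk ul]] := pbw_expansion2 Ek El.
have [alm|/kl0 [-> ->] //] := boolP (al \in m).
apply/subr0_eq; apply: (s_PBW.2 m (fun al => k al - l al)) => //.
rewrite -[RHS](subrr u) {1}uk ul -sumrB; apply: eq_bigr => be _.
by rewrite rmorphB mulrBl.
Qed.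

(** The spanning clause of [has_PBW_basis] allows repeated monomials, so the coefficients are
    accumulated term by term. *)
Lemma pbw_expansion_ex u : exists k, pbw_expansion u k.
Proof.
have [m [d ->]] := s_PBW.1 u; elim: m => [|al m [k Ek]].
  by exists (fun _ => 0); rewrite big_nil; apply: pbw_expansion0.
rewrite big_cons; eexists; apply: pbw_expansionD; last exact: Ek.
exact/pbw_expansionMl/pbw_expansion_monom.
Qed.

Section Growth.
Variables (B : pzRingType) (f : {rmorphism D -> B}).
Variables (phi : {rmorphism biquad s -> B}) (psi : {rmorphism B -> biquad s}).
Hypothesis phiK : cancel phi psi.
Hypothesis psi_f : forall d, psi (f d) = bq_coef s d.
Variables (L : finType) (y : L -> B).
Hypothesis yfC : forall i d, y i * f d = f d * y i.
Hypothesis comm : forall i j, wspan f y 1 (y i * y j - y j * y i).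
Hypothesis y_span : forall u, exists m, wspan f y m u.

(* The [d ^ n] monomials with exponents below [d] are D-combinations of fewer
   words in the [y i], which in turn have central coefficients over the PBW
   basis. So an identity matrix factors through a smaller size with a central
   second factor, and a kernel vector of that factor must vanish. This needs no
   invariant basis number property of [D]. *)
Lemma pbw_growth : (1 : D) != 0 -> (n <= #|L|)%N.
Proof.
move=> D1; rewrite leqNgt; apply/negP => Ln.
have [e xe] : exists e, forall i, wspan f y e (phi (bq_x s i)).
  have [m mP] := fin_all_exists (fun i => y_span (phi (bq_x s i))).
  by exists (\max_i m i) => i; apply: wspan_widen (mP i); apply: leq_bigmax.
(* A monomial with exponents below [d] lies in degree at most n(de) = [M]. The number of sorted
   words is at most (nde+1)^(n-1), hence at most (ne+1)^(n-1) d^(n-1), and this [d] is the least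
   that makes the last product smaller than d^n. *)
pose d := ((n * e).+1 ^ n.-1).+1.
pose M := (n * (d * e))%N.
have card_lt : (M.+1 ^ #|L| < d ^ n)%N.
  have n0 : (0 < n)%N by apply: leq_ltn_trans Ln.
  apply: (@leq_ltn_trans (((n * e).+1 * d) ^ n.-1)).
    apply: (@leq_trans (M.+1 ^ n.-1)).
      by rewrite leq_pexp2l // -ltnS prednK.
    case: (n.-1) => // p; rewrite leq_exp2r // /M mulSn.
    by rewrite [(d * e)%N]mulnC mulnA -add1n leq_add2r.
  by rewrite -[X in (_ < _ ^ X)%N](prednK n0) expnS expnMn ltn_pmul2r ?expn_gt0.
pose hat (al : {ffun 'I_n -> 'I_d}) : mon := [ffun i => al i : nat].
have hat_inj : injective hat.
  move=> al be /ffunP E; apply/ffunP => i; apply: val_inj.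
  by have := E i; rewrite !ffunE.
have g_ex al : exists g : {ffun L -> 'I_M.+1} -> D,
    phi (bq_monom s (hat al)) = \sum_be f (g be) * word y (sorted_word be).
  apply: (wspan_sorted yfC comm (leqnn M)).
  rewrite /bq_monom rmorph_prod /M.
  have sz : size (index_enum 'I_n) = n.
    rewrite -(card_uniqP (index_enum_uniq _)) -[RHS]card_ord.
    by apply: eq_card => i; rewrite mem_index_enum.
  rewrite -[X in wspan _ _ (X * _)]sz.
  apply: (wspan_prod yfC) => i; rewrite rmorphXn.
  apply: (@wspan_widen _ _ _ _ _ (hat al i * e)); last exact: wspanX.
  by rewrite leq_mul2r ffunE ltnW ?orbT.
have [g gP] := fin_all_exists g_ex.
have [k kP] := fin_all_exists (fun be : {ffun L -> 'I_M.+1} =>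
  pbw_expansion_ex (psi (word y (sorted_word be)))).
(* Words commute with [D], so multiplying by [r] on either side gives two expansions of one element,
   which agree by uniqueness. *)
have k_central be al : ring_central (k be al).
  move=> r; have := pbw_expansionMl r (kP be).
  rewrite -psi_f -rmorphM -(word_fC yfC) rmorphM psi_f => E.
  exact: (pbw_expansion_uniq (pbw_expansionMr r (kP be)) E).
have id_fact al ga : \sum_be g al be * k be ga = (ga == hat al)%:R.
  have E : pbw_expansion (bq_monom s (hat al)) (fun ga => \sum_be g al be * k be ga).
    rewrite -[bq_monom s _]phiK gP rmorph_sum; apply: pbw_expansion_sum => be.
    by rewrite rmorphM psi_f; apply: pbw_expansionMl.
  exact: (pbw_expansion_uniq E (pbw_expansion_monom _)).
have [||v [[i vi] v0]] := @central_matrix_kernel D {ffun 'I_n -> 'I_d}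
  {ffun L -> 'I_M.+1} (fun be al => k be (hat al)) D1.
- by rewrite !card_ffun !card_ord.
- by move=> be al; apply: k_central.
(* By [id_fact] the coordinate [v i] is a combination of the sums that [v0] makes zero. *)
case/eqP: vi; transitivity (\sum_al (hat al == hat i)%:R * v al).
  rewrite (bigD1 i) //= eqxx mul1r big1 ?addr0 // => j ji.
  by rewrite (inj_eq hat_inj) (negbTE ji) mul0r.
under eq_bigr do rewrite -id_fact mulr_suml.
rewrite exchange_big big1 //= => be _.
by under eq_bigr do rewrite -mulrA; rewrite -mulr_sumr v0 mulr0.
Qed.

End Growth.

End PBWExpansion.

Lemma iso_over_inv (D A B : pzRingType) (f : D -> A) (g : D -> B) :
  iso_over f g -> exists (phi : {rmorphism A -> B}) (psi : {rmorphism B -> A}),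
  [/\ cancel phi psi, cancel psi phi, forall d, phi (f d) = g d &
      forall d, psi (g d) = f d].
Proof.
case=> phi [[psi phiK psiK] phi_f].
pose aP := GRing.isZmodMorphism.Build _ _ psi (can2_zmod_morphism phiK psiK).
pose mP := GRing.isMonoidMorphism.Build _ _ psi (can2_monoid_morphism phiK psiK).
pose psi' : {rmorphism B -> A} := HB.pack psi aP mP.
by exists phi, psi'; split=> // d; rewrite -phi_f; apply: phiK.
Qed.

Lemma iso_over_trans (D A B C : pzRingType) (f : D -> A) (g : D -> B) (h : D -> C) :
  iso_over f g -> iso_over g h -> iso_over f h.
Proof.
move=> [phi [phi_bij phi_f]] [psi [psi_bij psi_g]]; exists (psi \o phi); split.
  exact: bij_comp.
by move=> d; rewrite /= phi_f.
Qed.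

Lemma iso_over_sym (D A B : pzRingType) (f : D -> A) (g : D -> B) :
  iso_over f g -> iso_over g f.
Proof.
case/iso_over_inv=> phi [psi [phiK psiK _ psi_g]].
by exists psi; split; first exists phi.
Qed.

(** If some [c p] is nonzero, x_p is a combination of 1 and the other generators. These n - 1
    generators then generate the algebra over [D], with commutators still of degree at most 1,
    against [pbw_growth]. *)
Lemma lie_type_independent (K : fieldType) (D : kalgType K) n (s t : bq_data D n)
    (c0 : K) (c : 'I_n -> K) :
  has_PBW_basis s -> scalar_data t -> lie_type_data t ->
  iso_over (bq_coef s) (bq_coef t) -> (1 : D) != 0 ->
  bq_scalar t c0 + \sum_i bq_scalar t (c i) * bq_x t i = 0 ->
  c0 = 0 /\ forall i, c i = 0.
Proof.
move=> s_PBW t_scalar t_lie /iso_over_inv[phi [psi [phiK psiK phi_c psi_c]]] D1 rel.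
have c_eq0 p : c p = 0.
  apply/eqP/negPn/negP => cp.
  pose L := {i : 'I_n | i != p}.
  pose y (i : L) := bq_x t (val i).
  have yfC i d : y i * bq_coef t d = bq_coef t d * y i by apply: bq_x_coefC.
  have x_span i : wspan (bq_coef t) y 1 (bq_x t i).
    have [->|ip] := eqVneq i p; last exact: (wspan_gen _ y (Sub i ip)).
    have -> : bq_x t p = bq_scalar t (- (c p)^-1)
        * (bq_scalar t c0 + \sum_(i | i != p) bq_scalar t (c i) * bq_x t i).
      move: rel; rewrite (bigD1 p) //= addrCA => /eqP; rewrite addr_eq0 => /eqP E.
      rewrite rmorphN mulNr -mulrN -E mulrA.
      by rewrite -(rmorphM (bq_scalar t)) mulVf // rmorph1 mul1r.
    apply: wspanMl; apply: wspanD.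
      exact: (wspan_widen (leq0n 1) (wspan_coef _ y _)).
    by apply: wspan_sum => j jp; apply: wspanMl; apply: (wspan_gen _ y (Sub j jp)).
  have comm_lt (i j : 'I_n) : (j < i)%N ->
      wspan (bq_coef t) y 1 (bq_x t i * bq_x t j - bq_x t j * bq_x t i).
    move=> ji; rewrite bq_x_rel // t_lie // rmorph1 mul1r addrAC subrr add0r.
    apply: wspanD; last exact: (wspan_widen (leq0n 1) (wspan_coef _ y _)).
    by apply: wspan_sum => k _; apply: wspanMl.
  have comm i j : wspan (bq_coef t) y 1 (y i * y j - y j * y i).
    rewrite /y; case: (ltngtP (val i) (val j)) => [ij|ji|/val_inj ->].
    - by rewrite -opprB; apply: wspanN; apply: comm_lt.
    - exact: comm_lt.
    - by rewrite subrr; apply: wspan0.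
  have y_span u : exists m, wspan (bq_coef t) y m u.
    elim/biquad_ind: u => [d|i|u v [m Wu] [m' Wv]|u [m Wu]|u v [m Wu] [m' Wv]].
    - by exists 0%N; apply: wspan_coef.
    - by exists 1%N.
    - exists (m + m')%N; apply: wspanD; first exact: (wspan_widen (leq_addr _ _) Wu).
      exact: (wspan_widen (leq_addl _ _) Wv).
    - by exists m; apply: wspanN.
    - by exists (m + m')%N; apply: wspanM.
  have := pbw_growth s_PBW phiK psi_c yfC comm y_span D1.
  rewrite card_sig; have := cardC1 p; rewrite card_ord => ->.
  by rewrite leqNgt ltn_predL (leq_ltn_trans (leq0n p) (ltn_ord p)).
(* A nonzero [c0] would be an invertible scalar mapped to 0, so both algebras would collapse,
   whereas the empty monomial of [s] is independent over [D]. *)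
split=> //; apply/eqP/negPn/negP => c00.
have E : bq_scalar t c0 = 0.
  by rewrite -[RHS]rel big1 ?addr0 // => i _; rewrite c_eq0 rmorph0 mul0r.
have t1 : (1 : biquad t) = 0.
  have := rmorphM (bq_scalar t) c0^-1 c0; rewrite mulVf // rmorph1 => ->.
  by rewrite -[X in _ * X]/(bq_scalar t c0) E mulr0.
have s1 : (1 : biquad s) = 0 by rewrite -(rmorph1 psi) t1 rmorph0.
have := pbw_expansion_monom s [ffun _ => 0%N].
have -> : bq_monom s [ffun=> 0%N] = 0 by rewrite -[LHS]mul1r s1 mul0r.
move/(pbw_expansion_uniq s_PBW (pbw_expansion0 s))/(_ [ffun=> 0%N]).
by rewrite eqxx => /eqP; rewrite eq_sym (negbTE D1).
Qed.

(** * The Lie algebra of a Lie type presentation *)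

Lemma adapted_basis_pair (K : fieldType) n :
  adapted_basis ((1, 0) : K^o * 'rV[K]_n) (fun i => (0, delta_mx 0 i))
    fst (fun x i => x.2 0 i).
Proof.
split=> //=.
- case=> x1 x2 /=; rewrite [X in (_, X) = _](row_sum_delta x2).
  have -> : (x1, \sum_(j < n) x2 0 j *: delta_mx 0 j)
      = x1 *: ((1, 0) : K^o * 'rV[K]_n) + (0, \sum_(j < n) x2 0 j *: delta_mx 0 j).
    by congr (_, _); rewrite /= ?scaler0 ?add0r // addr0 [_ *: _]mulr1.
  congr (_ + _); elim: (index_enum _) => [|i r IH]; first by rewrite !big_nil.
  by rewrite !big_cons -IH; congr (_, _); rewrite /= scaler0 addr0.
- by move=> c x y i; rewrite !mxE.
- by move=> i; rewrite mxE.
- by move=> i j; rewrite mxE eqxx eq_sym.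
Qed.

Lemma dim_KrV (K : fieldType) n : \dim {: (K^o * 'rV[K]_n)%type} = n.+1.
Proof. by rewrite dimvf -[LHS]/(1 + 1 * n)%N mul1n. Qed.

Lemma KrV_one0 (K : fieldType) n : ((1, 0) : K^o * 'rV[K]_n) != 0.
Proof. by apply/eqP => /(congr1 fst) /eqP; rewrite oner_eq0. Qed.

(** The witness for the case where [D] is the zero ring. *)
Lemma abelian_lie_algebra (K : fieldType) n : exists (G : lieAlgType K) (Z : G),
  [/\ \dim {:G} = n.+1, lie_center Z & Z != 0].
Proof.
pose V := (K^o * 'rV[K]_n)%type.
have brD (x y z : V) : 0 = 0 + 0 :> V by rewrite addr0.
have brZ (c : K) (x y : V) : 0 = c *: 0 :> V by rewrite scaler0.
have jacobi (x y z : V) : 0 + 0 + 0 = 0 :> V by rewrite !addr0.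
pose lieP := @isLieAlgebra.Build K V (fun _ _ => 0)
  brD brD brZ brZ (fun _ => erefl) jacobi.
pose G : lieAlgType K := HB.pack V lieP.
by exists G, ((1, 0) : V); split=> //; [apply: dim_KrV | apply: KrV_one0].
Qed.

Section LieAlgebraOfData.
Variables (K : fieldType) (D : kalgType K) (n : nat) (t : bq_data D n).
Variables (a : 'I_n -> 'I_n -> 'I_n -> K) (b : 'I_n -> 'I_n -> K).
Hypothesis t_lie : lie_type_data t.
Hypothesis t_a : forall i j k : 'I_n, (j < i)%N -> bq_a t i j k = kscalar (a i j k).
Hypothesis t_b : forall i j : 'I_n, (j < i)%N -> bq_b t i j = kscalar (b i j).
Hypothesis indep : forall (c0 : K) (c : 'I_n -> K),
  bq_scalar t c0 + \sum_i bq_scalar t (c i) * bq_x t i = 0 ->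
  c0 = 0 /\ forall i, c i = 0.

Local Notation V := (K^o * 'rV[K]_n)%type.
Local Notation e := (fun i : 'I_n => (0, delta_mx 0 i) : V).
Local Notation w := (fun (x : V) i => x.2 0 i).
Local Notation eta := (bq_eta t (fst : V -> K) w).

Definition struct_const (i j : 'I_n) : V :=
  if (j < i)%N then (b i j, \row_k a i j k)
  else if (i < j)%N then - (b j i, \row_k a j i k) else 0.

Definition bq_br (x y : V) : V :=
  \sum_i \sum_j (x.2 0 i * y.2 0 j) *: struct_const i j.

Lemma struct_constN i j : struct_const i j = - struct_const j i.
Proof. by rewrite /struct_const; case: ltngtP; rewrite ?opprK ?oppr0. Qed.

Lemma bq_brl c x y v : bq_br (c *: x + y) v = c *: bq_br x v + bq_br y v.
Proof.
rewrite /bq_br scaler_sumr -big_split; apply: eq_bigr => i _ /=.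
rewrite scaler_sumr -big_split; apply: eq_bigr => j _ /=.
by rewrite !mxE mulrDl scalerDl scalerA mulrA.
Qed.

Lemma bq_brr c x y v : bq_br v (c *: x + y) = c *: bq_br v x + bq_br v y.
Proof.
rewrite /bq_br scaler_sumr -big_split; apply: eq_bigr => i _ /=.
rewrite scaler_sumr -big_split; apply: eq_bigr => j _ /=.
by rewrite !mxE mulrDr scalerDl scalerA mulrCA.
Qed.

Lemma bq_br_e i j : bq_br (e i) (e j) = struct_const i j.
Proof.
rewrite /bq_br (bigD1 i) //= [X in _ + X]big1 ?addr0.
  rewrite (bigD1 j) //= !mxE !eqxx mulr1 scale1r big1 ?addr0 // => k kj.
  by rewrite !mxE (negbTE kj) mulr0 scale0r.
move=> k ki; rewrite big1 // => l _.
by rewrite !mxE (negbTE ki) mul0r scale0r.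
Qed.

Lemma bq_br_Zl x : bq_br (1, 0) x = 0.
Proof.
by rewrite /bq_br big1 // => i _; rewrite big1 // => j _; rewrite mxE mul0r scale0r.
Qed.

Lemma bq_br_Zr x : bq_br x (1, 0) = 0.
Proof.
by rewrite /bq_br big1 // => i _; rewrite big1 // => j _; rewrite mxE mulr0 scale0r.
Qed.

Lemma bq_br_e_basis (i j : 'I_n) : (j < i)%N ->
  bq_br (e i) (e j) = \sum_k a i j k *: e k + b i j *: ((1, 0) : V).
Proof.
move=> ji; rewrite bq_br_e /struct_const ji.
rewrite [LHS](basis_decomp (adapted_basis_pair K n)) addrC; congr (_ + _).
by apply: eq_bigr => k _; rewrite mxE.
Qed.

Lemma bq_br_comm x y : eta x * eta y - eta y * eta x = eta (bq_br x y).
Proof.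
apply: (bq_eta_comm t_lie t_a t_b (adapted_basis_pair K n)).
- exact: bq_brl.
- exact: bq_brr.
- exact: bq_br_Zl.
- exact: bq_br_Zr.
- by move=> i; rewrite bq_br_e /struct_const ltnn.
- by move=> i j; rewrite !bq_br_e struct_constN.
- exact: bq_br_e_basis.
Qed.

(** Independence makes [eta] injective, so identities between commutators in the algebra descend to
    the bracket on [V]. *)
Lemma bq_eta_eq0 x : eta x = 0 -> x = 0.
Proof.
case: x => x1 x2 /indep[/= -> x20]; congr (_, _).
by apply/rowP => i; rewrite x20 mxE.
Qed.

Let eta_linear := bq_eta_linear t (adapted_basis_pair K n).

Lemma bq_brxx x : bq_br x x = 0.
Proof. by apply: bq_eta_eq0; rewrite -bq_br_comm subrr. Qed.

Lemma bq_jacobi x y v :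
  bq_br x (bq_br y v) + bq_br y (bq_br v x) + bq_br v (bq_br x y) = 0.
Proof.
apply: bq_eta_eq0; rewrite !(semilinearD eta_linear) -!bq_br_comm.
move: eta => h; move: (h x) (h y) (h v) => p q r.
(* What remains is the Jacobi identity for commutators in an associative ring; [E] groups the twelve
   products so that they telescope. *)
have E (i j k l : biquad t) : i - j - (k - l) = i + l - (j + k).
  by rewrite opprB addrACA opprD.
rewrite !mulrBl !mulrBr !mulrA !E.
rewrite (addrC (p * r * q)) (addrC (q * p * r)) (addrC (r * q * p)).
by rewrite !subrKA subrr.
Qed.

Lemma lie_algebra_of_data : exists (G : lieAlgType K) (Z : G),
  [/\ \dim {:G} = n.+1, lie_center Z, Z != 0 &
      iso_over (bq_coef t) (tensor_l (uea_mod1 Z) : D -> tensor D (uea_mod1 Z))].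
Proof.
have brDl x y v : bq_br (x + y) v = bq_br x v + bq_br y v.
  by rewrite -[x]scale1r bq_brl !scale1r.
have brDr x y v : bq_br x (y + v) = bq_br x y + bq_br x v.
  by rewrite -[y]scale1r bq_brr !scale1r.
(* Writing 0 as -Z + Z makes brackets with 0 vanish by the centrality of [Z]. *)
have V0 : 0 = -1 *: ((1, 0) : V) + (1, 0) by rewrite scaleN1r addNr.
have br0 x : bq_br 0 x = 0 by rewrite V0 bq_brl bq_br_Zl scaler0 addr0.
have br0' x : bq_br x 0 = 0 by rewrite {1}V0 bq_brr bq_br_Zr scaler0 addr0.
have brZl c x y : bq_br (c *: x) y = c *: bq_br x y.
  by rewrite -[c *: x]addr0 bq_brl br0 addr0.
have brZr c x y : bq_br x (c *: y) = c *: bq_br x y.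
  by rewrite -[c *: y]addr0 bq_brr br0' addr0.
pose lieP := isLieAlgebra.Build K V brDl brDr brZl brZr bq_brxx bq_jacobi.
pose G : lieAlgType K := HB.pack V lieP.
exists G, ((1, 0) : V); split.
- exact: dim_KrV.
- exact: bq_br_Zl.
- exact: KrV_one0.
- apply: (@tensor_iso _ _ _ t a b t_lie t_a t_b G _ e fst w).
  + exact: adapted_basis_pair.
  + exact: bq_br_Zl.
  + move=> i j ji; rewrite -[LHS]/(bq_br (e i) (e j)) bq_br_e_basis //.
  + exact: uea_mod1_spec.
Qed.

End LieAlgebraOfData.

(** * From a Lie algebra with a central element to a presentation, and the equivalence *)

Lemma lie_central_basis (K : fieldType) (G : vectType K) n (Z : G) :
  \dim {:G} = n.+1 -> Z != 0 ->
  exists (e : 'I_n -> G) (z : G -> K) (w : G -> 'I_n -> K), adapted_basis Z e z w.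
Proof.
move=> dimG Z0; pose W := (<[Z]>^C)%VS.
have dimW : \dim W = n by rewrite dimv_compl dim_vline Z0 dimG subn1.
pose vb := tcast dimW (vbasis W).
have X_basis : basis_of {:G} [tuple of Z :: vb].
  rewrite /= val_tcast -cat1s -(addv_complf <[Z]>); apply: cat_basis.
  - by apply/directv_addP; apply: capv_compl.
  - exact: seq1_basis.
  - exact: vbasisP.
pose X := [tuple of Z :: vb]; have X_free := basis_free X_basis.
(* Position 0 of [X] holds [Z]; the positions [lift ord0 i] hold a basis of a complement of its
   line. *)
exists (fun i => X`_(lift ord0 i)), (coord X ord0),
  (fun x i => coord X (lift ord0 i) x).
split.
- by move=> x; rewrite {1}(coord_basis X_basis (memvf x)) big_ord_recl.
- by move=> c x y; rewrite linearP.
- by move=> c x y i; rewrite linearP.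
- by rewrite (coord_free ord0 ord0 X_free).
- by move=> i; rewrite (coord_free ord0 (lift ord0 i) X_free).
- by move=> i; rewrite (coord_free (lift ord0 i) ord0 X_free).
- by move=> i j; rewrite (coord_free _ _ X_free) (inj_eq lift_inj).
Qed.

Lemma lie_presentation (K : fieldType) (D : kalgType K) n (G : lieAlgType K) (Z : G) :
  \dim {:G} = n.+1 -> lie_center Z -> Z != 0 ->
  exists t : bq_data D n, [/\ scalar_data t, lie_type_data t &
    iso_over (bq_coef t) (tensor_l (uea_mod1 Z) : D -> tensor D (uea_mod1 Z))].
Proof.
move=> dimG ZC Z0; have [e [z [w bas]]] := lie_central_basis dimG Z0.
have one_central : ring_central (1 : D) by move=> r; rewrite mul1r mulr1.
pose a i j k : K := w (lie_br (e i) (e j)) k.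
pose b i j : K := z (lie_br (e i) (e j)).
pose t := @BQData D n (fun _ _ => 1) (fun i j k => kscalar (a i j k))
  (fun i j => kscalar (b i j)) (fun _ _ _ => one_central).
exists t; split=> //.
  by move=> i j _; split=> [k|]; [exists (a i j k) | exists (b i j)].
apply: (@tensor_iso _ _ _ t a b _ _ _ G Z e z w) => //.
- by move=> i j _; rewrite [LHS](basis_decomp bas) addrC.
- exact: uea_mod1_spec.
Qed.

Lemma iso_over_trivial (D A B : pzRingType) (f : {rmorphism D -> A})
    (g : {rmorphism D -> B}) : (1 : D) = 0 -> iso_over f g.
Proof.
move=> D10.
have A0 (u : A) : u = 0 by rewrite -[u]mul1r -(rmorph1 f) D10 rmorph0 mul0r.
have B0 (u : B) : u = 0 by rewrite -[u]mul1r -(rmorph1 g) D10 rmorph0 mul0r.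
have zA : additive (fun _ : A => 0 : B) by move=> u v; rewrite subr0.
have zM : monoid_morphism (fun _ : A => 0 : B).
  by split=> [|u v]; [rewrite [RHS]B0 | rewrite mulr0].
pose aP := GRing.isZmodMorphism.Build _ _ _ zA.
pose mP := GRing.isMonoidMorphism.Build _ _ _ zM.
pose phi : {rmorphism A -> B} := HB.pack (fun _ : A => 0 : B) aP mP.
exists phi; split=> [|d]; last by rewrite [RHS]B0.
by exists (fun _ => 0) => u; rewrite ?[u in RHS]A0 ?[u in RHS]B0.
Qed.

Theorem theorem1p2 (K : fieldType) (D : kalgType K) (n : nat)
    (n_ge2 : (2 <= n)%N) (s : bq_data D n)
    (s_scalar : scalar_data s) (s_PBW : has_PBW_basis s) :
  of_lie_type s <->
  exists (G : lieAlgType K) (Z : G),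
    [/\ \dim {:G} = n.+1, lie_center Z, Z != 0 &
        iso_over (bq_coef s) (tensor_l (uea_mod1 Z) : D -> tensor D (uea_mod1 Z))].
Proof.
split=> [[t [t_scalar t_lie st]]|[G [Z [dimG ZC Z0 sU]]]]; last first.
  have [t [t_scalar t_lie tU]] := lie_presentation D dimG ZC Z0.
  by exists t; split=> //; apply: iso_over_trans sU (iso_over_sym tU).
(* If 1 = 0 in [D], both sides of the isomorphism are zero rings and any [G] of the right dimension
   with a nonzero central element will do. *)
have [D10|D1] := eqVneq (1 : D) 0.
  have [G [Z [dimG ZC Z0]]] := abelian_lie_algebra K n.
  by exists G, Z; split=> //; apply: iso_over_trivial.
(* Only entries with j < i are known to be scalars; the guard, with default 0 elsewhere, makes total
   choice functions possible. *)
have a_ex (p : 'I_n * 'I_n * 'I_n) : exists c : K, (p.1.2 < p.1.1)%N ->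
    bq_a t p.1.1 p.1.2 p.2 = kscalar c.
  case: p => -[i j] k /=.
  by have [_|/t_scalar[/(_ k)[c ->] _]] := leqP i j; [exists 0 | exists c].
have b_ex (p : 'I_n * 'I_n) : exists c : K, (p.2 < p.1)%N ->
    bq_b t p.1 p.2 = kscalar c.
  case: p => i j /=.
  by have [_|/t_scalar[_ [c ->]]] := leqP i j; [exists 0 | exists c].
have [a t_a] := choice a_ex; have [b t_b] := choice b_ex.
have [] := @lie_algebra_of_data _ _ _ t (fun i j k => a (i, j, k))
  (fun i j => b (i, j)) t_lie (fun i j k => t_a (i, j, k)) (fun i j => t_b (i, j)).
  by move=> c0 c; apply: (lie_type_independent s_PBW t_scalar t_lie st D1).
move=> G [Z [dimG ZC Z0 tU]]; exists G, Z; split=> //.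
exact: iso_over_trans st tU.
Qed.
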